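(* Let $\Omega\subset\mathbb R^d$ be open and $\omega\in\mathcal W$. The two definitions of Roumieu regularity are equivalent, that is, $$\mathcal E^{\{\omega\},\infty}(\Omega)=\tilde{\mathcal E}^{\{\omega\},\infty}(\Omega).$$
   Context: $\mathbb R^+=[0,\infty)$. $\mathcal W$ is the set of all nondecreasing continuous functions $\omega:\mathbb R^+\to\mathbb R^+$ such that $\omega(0)=0$; $\omega(x+y)\le\omega(x)+\omega(y)$ for all $x,y\ge 0$; $\int_1^\infty \frac{\omega(t)}{t^2}\,dt<\infty$; and $\lim_{t\to\infty}\frac{\omega(t)}{\log(1+t)}=\infty$. For $\omega_1,\omega_2\in\mathcal W$, $\omega_1\ll\omega_2$ means $\omega_1(t)=o(\omega_2(t))$ as $t\to\infty$. For a compactly supported continuous $f$ on $\mathbb R^d$, $\sigma\in\mathcal W$, $l>0$: $\|f\|_l^{\sigma}=\int|\hat f(\xi)|e^{l\sigma(|\xi|)}d\xi\in[0,\infty]$. $\mathcal D^{\{\omega\}}(\Omega)$ is the set of continuous $f$ with compact support in $\Omega$ and $\|f\|_l^\omega<\infty$ for some $l>0$. $\mathcal E^{\{\omega\}}(\Omega)$ is the set of smooth $f:\Omega\to\mathbb C$ such that $\psi f\in\mathcal D^{\{\omega\}}(\Omega)$ for all $\psi\in\mathcal D^{\{\omega\}}(\Omega)$. For compact $K\subset\Omega$, $\|f\|_{K,l}^{\sigma}=\inf\{\|\psi f\|_l^{\sigma}:\psi\in\mathcal D^{\{\omega\}}(\Omega),\ \psi=1\text{ on }K\}$. Nets are indexed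 by $\varepsilon\in(0,1)$, $o(\cdot)$ is as $\varepsilon\to0^+$, $K$ ranges over compact subsets of $\Omega$, $\omega_1,\omega_2$ over $\mathcal W$. $\mathcal E_M^{\{\omega\}}(\Omega)$ is the set of nets in $\mathcal E^{\{\omega\}}(\Omega)$ such that $\forall K\,\forall k>0\,\exists h>0$: $\|g_\varepsilon\|_{K,h}^\omega=o(e^{k\omega(1/\varepsilon)})$. - $\mathcal E^{\{\omega\},\infty}(\Omega)$: the nets $(g_\varepsilon)\in\mathcal E_M^{\{\omega\}}(\Omega)$ such that $\forall K\ \exists h>0\ \forall k>0$: $\|g_\varepsilon\|_{K,h}^\omega=o(e^{k\omega(1/\varepsilon)})$. - $\tilde{\mathcal E}^{\{\omega\},\infty}(\Omega)$: the nets $(g_\varepsilon)\in\mathcal E_M^{\{\omega\}}(\Omega)$ such that $\forall K\ \exists\omega_1\ll\omega\ \forall\omega_2\ll\omega$: $\|g_\varepsilon\|_{K,1}^{\omega_2}=o(e^{\omega_1(1/\varepsilon)})$. *)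

(* Defs.v *)
From HB Require Import structures.
From mathcomp Require Import all_boot all_order all_algebra.
From mathcomp Require Import all_classical all_reals all_analysis.
From mathcomp Require Import complex.

Set Implicit Arguments.
Unset Strict Implicit.
Unset Printing Implicit Defensive.

Import Order.TTheory GRing.Theory Num.Theory.
Import numFieldNormedType.Exports.
Local Open Scope classical_set_scope.
Local Open Scope ring_scope.

(* ['rV[T]_n] carries the product sigma-algebra, generated by the coordinate
   maps; for [T = R] this is the Borel sigma-algebra of R^n. *)
Definition rV_display : measure_display -> measure_display.
Proof. exact. Qed.

Section measurable_rV.
Context {d} {T : measurableType d} (n : nat).

Let coords : 'I_n -> 'rV[T]_n -> T := fun i x => x ord0 i.

Let rV_set0 : g_sigma_preimage coords set0.
Proof. exact: sigma_algebra0. Qed.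

Let rV_setC A : g_sigma_preimage coords A -> g_sigma_preimage coords (~` A).
Proof. exact: sigma_algebraC. Qed.

Let rV_bigcup (F : _^nat) : (forall i, g_sigma_preimage coords (F i)) ->
  g_sigma_preimage coords (\bigcup_i (F i)).
Proof. exact: sigma_algebra_bigcup. Qed.

HB.instance Definition _ := @isMeasurable.Build (rV_display d)
  'rV[T]_n (g_sigma_preimage coords) rV_set0 rV_setC rV_bigcup.

End measurable_rV.

Section rV_cons.
Context {d} {T : measurableType d} (n : nat).

Definition rV_cons (p : T * 'rV[T]_n) : 'rV[T]_n.+1 :=
  \row_i oapp (fun j : 'I_n => p.2 ord0 j) p.1 (unlift ord0 i).

Lemma rV_consK : cancel rV_cons
  (fun v => (v ord0 ord0, \row_j v ord0 (lift ord0 j))).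
Proof.
move=> [x v]; rewrite /rV_cons mxE unlift_none /=; congr pair.
by apply/rowP => j; rewrite !mxE liftK.
Qed.

Lemma measurable_coord (i : 'I_n) :
  measurable_fun [set: 'rV[T]_n] (fun v : 'rV[T]_n => v ord0 i).
Proof.
move=> _ Y mY; rewrite setTI; apply: sub_sigma_algebra => /=.
rewrite -bigcup_seq/=; exists i => /=; first by rewrite mem_index_enum.
by exists Y => //; rewrite setTI.
Qed.

End rV_cons.

Lemma measurable_fun_rV d1 d2 (T1 : measurableType d1) (T2 : measurableType d2)
    n (f : T1 -> 'rV[T2]_n) :
  (forall i, measurable_fun [set: T1] (fun x => f x ord0 i)) ->
  measurable_fun [set: T1] f.
Proof.
move=> mf _ Y /= mY; rewrite setTI.
have : g_sigma_preimage (fun i x => f x ord0 i) `<=` @measurable _ T1.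
  apply: smallest_sub; first exact: sigma_algebra_measurable.
  by rewrite -bigcup_seq => A [i _ [B mB <-]]; exact: mf.
apply; rewrite -/((fun i x => f x ord0 i)).
rewrite (g_sigma_preimage_comp (fun i (v : 'rV[T2]_n) => v ord0 i) f).
by exists Y => //; rewrite setTI.
Qed.

Lemma measurable_rV_cons d (T : measurableType d) n :
  measurable_fun [set: T * 'rV[T]_n] (@rV_cons d T n).
Proof.
apply: measurable_fun_rV => i.
rewrite (_ : (fun _ => _) = fun p : T * 'rV[T]_n =>
   oapp (fun j : 'I_n => p.2 ord0 j) p.1 (unlift ord0 i)); last first.
  by apply/funext => p; rewrite mxE.
case: unliftP => [j _|_] /=; last exact: measurable_fst.
exact: (measurableT_comp (measurable_coord j) measurable_snd).
Qed.

Section rV_cons_measure.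
Local Open Scope ereal_scope.
Context {R : realType} (n : nat).
Variable mu : {sigma_finite_measure set 'rV[R]_n -> \bar R}.

Definition rV_cons_measure : set 'rV[R]_n.+1 -> \bar R :=
  pushforward (lebesgue_measure \x mu) (@rV_cons _ R n).

Let rV_cons_measure0 : rV_cons_measure set0 = 0.
Proof. by rewrite /rV_cons_measure /pushforward preimage_set0 measure0. Qed.

Let rV_cons_measure_ge0 A : 0 <= rV_cons_measure A.
Proof. by rewrite /rV_cons_measure /pushforward measure_ge0. Qed.

Let rV_cons_measure_sigma_additive : semi_sigma_additive rV_cons_measure.
Proof.
move=> F mF tF mUF; rewrite /rV_cons_measure /pushforward preimage_bigcup.
have mpre A : measurable A -> measurable (@rV_cons _ R n @^-1` A).
  by move=> mA; rewrite -[X in measurable X]setTI; exact: measurable_rV_cons.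
apply: measure_semi_sigma_additive.
- by move=> k; exact: mpre.
- apply/trivIsetP => /= i j _ _ ij; rewrite -preimage_setI.
  by move/trivIsetP : tF => /(_ _ _ _ _ ij) ->//; rewrite preimage_set0.
- by rewrite -preimage_bigcup; exact: mpre.
Qed.

HB.instance Definition _ := isMeasure.Build _ _ _ rV_cons_measure
  rV_cons_measure0 rV_cons_measure_ge0 rV_cons_measure_sigma_additive.

Let rV_cons_measure_sigma_finite :
  sigma_finite [set: 'rV[R]_n.+1] rV_cons_measure.
Proof.
have /sigma_finiteP[F [TF ndF Foo]] := sigma_finiteT (@lebesgue_measure R).
have /sigma_finiteP[G [TG ndG Goo]] := sigma_finiteT mu.
pose tl (v : 'rV[R]_n.+1) : R * 'rV[R]_n :=
  (v ord0 ord0, \row_j v ord0 (lift ord0 j)).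
have mtl : measurable_fun [set: 'rV[R]_n.+1] tl.
  apply: measurable_fun_pair; first exact: measurable_coord.
  apply: measurable_fun_rV => i.
  rewrite (_ : (fun _ => _) = fun v : 'rV[R]_n.+1 => v ord0 (lift ord0 i)).
    exact: measurable_coord.
  by apply/funext => v; rewrite mxE.
exists (fun k => tl @^-1` (F k `*` G k)).
  rewrite -preimage_bigcup (_ : \bigcup_k _ = setT) ?preimage_setT//.
  rewrite -setXTT TF TG predeqE => -[x y]; split.
    by move=> [k _ []/= ? ?]; split; exists k.
  move=> [/= [m _ Fmx] [k _ Gky]]; exists (maxn m k) => //; split.
  - by move: x Fmx; exact/subsetPset/ndF/leq_maxl.
  - by move: y Gky; exact/subsetPset/ndG/leq_maxr.
move=> k; have [mF ?] := Foo k; have [mG ?] := Goo k; split.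
  by rewrite -[X in measurable X]setTI; apply: mtl => //; exact: measurableX.
rewrite /rV_cons_measure /pushforward -comp_preimage.
rewrite (_ : tl \o _ = id) ?preimage_id; last first.
  by apply/funext => p; exact: rV_consK.
by rewrite product_measure1E// lte_mul_pinfty// ge0_fin_numE.
Qed.

HB.instance Definition _ := Measure_isSigmaFinite.Build _ _ _ rV_cons_measure
  rV_cons_measure_sigma_finite.

End rV_cons_measure.

Fixpoint lebesgue_rV {R : realType} (n : nat) :
    {sigma_finite_measure set 'rV[R]_n -> \bar R} :=
  if n is n'.+1 then rV_cons_measure (lebesgue_rV n') else \d_(0 : 'rV[R]_0).

Section weights.
Context {R : realType}.
Implicit Types w : R -> R.

(* A function R^+ -> R^+ is encoded as a function on R whose values at negative
   arguments are irrelevant. *)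
Definition weight w : Prop :=
  [/\ forall x, 0 <= x -> 0 <= w x,
      forall x y, 0 <= x -> x <= y -> w x <= w y,
      {within `[0, +oo[, continuous w} &
      w 0 = 0] /\
  [/\ forall x y, 0 <= x -> 0 <= y -> w (x + y) <= w x + w y,
      (\int[lebesgue_measure]_(t in `[1%R, +oo[) (w t / t ^+ 2)%:E < +oo)%E &
      w t / ln (1 + t) @[t --> +oo] --> +oo].

Definition weight_ll w1 w2 : Prop :=
  forall c, 0 < c -> \forall t \near +oo, `|w1 t| <= c * `|w2 t|.

(* [a e = o(b e)] as [e --> 0^+], for [a] nonnegative with values in [0, +oo]
   (so [a] is in particular finite near 0) and [b] positive. *)
Definition ereal_littleo0 (a : R -> \bar R) (b : R -> R) : Prop :=
  forall c, 0 < c -> \forall e \near 0^'+, (a e <= (c * b e)%:E)%E.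

End weights.

Section spaces.
Context {R : realType} {d : nat}.
Local Notation Rd := 'rV[R]_d.
Implicit Types (w sigma : R -> R) (Omega K : set Rd) (f psi : Rd -> R[i]).

(* The norm of the library on ['rV[R]_d] is the sup norm, hence [enorm]. *)
Definition dot (x y : Rd) : R := \sum_i x ord0 i * y ord0 i.
Definition enorm (x : Rd) : R := Num.sqrt (dot x x).

Definition expi (t : R) : R[i] := (cos t +i* sin t)%C.

Definition cintegral f : R[i] :=
  (Rintegral (lebesgue_rV d) setT (fun x => complex.Re (f x)) +i*
   Rintegral (lebesgue_rV d) setT (fun x => complex.Im (f x)))%C.

Definition fourier f (xi : Rd) : R[i] :=
  cintegral (fun x => f x * expi (- dot x xi)).

Definition wnorm sigma (l : R) f : \bar R :=
  \int[lebesgue_rV d]_xi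
    (Normc.normc (fourier f xi) * expR (l * sigma (enorm xi)))%:E.

(* C = R^2 as a real vector space: continuity and smoothness of a complex-valued
   function are those of its real and imaginary parts. *)
Definition ccontinuous f : Prop :=
  continuous (fun x => complex.Re (f x)) /\
  continuous (fun x => complex.Im (f x)).

Definition csupport f : set Rd := closure [set x | f x != 0].

(* D^{w}(Omega) *)
Definition test_functions w Omega : set (Rd -> R[i]) :=
  [set f | [/\ ccontinuous f, compact (csupport f), csupport f `<=` Omega &
    exists2 l, 0 < l & (wnorm w l f < +oo)%E]].

Fixpoint iter_partial (s : seq 'I_d) (u : Rd -> R) : Rd -> R :=
  if s is i :: s' then 'D_(delta_mx ord0 i) (iter_partial s' u) else u.

Definition smooth_on Omega (u : Rd -> R) : Prop :=
  forall s x, Omega x ->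
    {for x, continuous (iter_partial s u)} /\
    forall i, derivable (iter_partial s u) x (delta_mx ord0 i).

(* E^{w}(Omega). A function on [Omega] is encoded as a function on R^d whose
   values outside [Omega] are irrelevant: they never influence [psi * f], since
   [psi] is supported in [Omega]. *)
Definition local_functions w Omega : set (Rd -> R[i]) :=
  [set f | [/\ smooth_on Omega (fun x => complex.Re (f x)),
    smooth_on Omega (fun x => complex.Im (f x)) &
    forall psi, test_functions w Omega psi ->
      test_functions w Omega (fun x => psi x * f x)]].

(* The cutoffs always range over D^{w}(Omega), whatever the weight [sigma] of
   the norm. *)
Definition wseminorm w Omega K sigma (l : R) f : \bar R :=
  ereal_inf [set wnorm sigma l (fun x => psi x * f x) | psi in
    [set psi | test_functions w Omega psi /\ forall x, K x -> psi x = 1]].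

(* A net indexed by (0, 1) is encoded as a function on R whose values outside
   (0, 1) are irrelevant. *)
Definition moderate_nets w Omega : set (R -> Rd -> R[i]) :=
  [set g | (forall e, 0 < e -> e < 1 -> local_functions w Omega (g e)) /\
    forall K, compact K -> K `<=` Omega ->
    forall k, 0 < k -> exists2 h, 0 < h &
      ereal_littleo0 (fun e => wseminorm w Omega K w h (g e))
               (fun e => expR (k * w e^-1))].

Definition regular_nets w Omega : set (R -> Rd -> R[i]) :=
  [set g | moderate_nets w Omega g /\
    forall K, compact K -> K `<=` Omega ->
    exists2 h, 0 < h & forall k, 0 < k ->
      ereal_littleo0 (fun e => wseminorm w Omega K w h (g e))
               (fun e => expR (k * w e^-1))].

Definition regular_nets_tilde w Omega : set (R -> Rd -> R[i]) :=
  [set g | moderate_nets w Omega g /\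
    forall K, compact K -> K `<=` Omega ->
    exists w1, [/\ weight w1, weight_ll w1 w &
      forall w2, weight w2 -> weight_ll w2 w ->
      ereal_littleo0 (fun e => wseminorm w Omega K w2 1 (g e))
               (fun e => expR (w1 e^-1))]].

End spaces.

(* Main.v *)
Require Import Defs.
From mathcomp Require Import all_boot all_order all_algebra.
From mathcomp Require Import all_classical all_reals all_analysis.
From mathcomp Require Import measurable_realfun complex ring.

(** Both notions of regularity bound weighted L^1 norms of Fourier transforms; a
    net is regular when one multiple [h * w] of the weight works for all growth
    rates [k], and regular in the second sense when one growth rate [w1 << w]
    works for all weights [w2 << w]. The passage between one scale and
    infinitely many is made by two facts on weights.

    A function that is [o(w)] lies eventually below some weight [w1 << w]
    ([weight_minorant]). Such a weight is [phi o w], where [phi] is an infimum of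
    affine functions with slopes tending to 0. Conversely, [w2 << w] gives
    [w2 <= h * w + C] for every positive [h]. Together they yield the first
    inclusion, [regular_nets_sub]: the logarithm of the net of seminorms is
    [o(w (1/e))], so a single [w1] dominates it, and the constant [C] disappears
    in the little-o.

    For the second inclusion, a gliding-hump argument ([uniform_weight]) shows
    that densities which are bounded for each weight [w2 << w] are bounded for
    some [h * w]: otherwise mass escapes to infinity along annuli, and
    [weight_minorant] produces a weight below [w] that sees all of it. This
    concerns one function per parameter, whereas a seminorm is an infimum over
    cutoffs. A single cutoff [chi] equal to 1 on [K] is supplied by moderateness
    ([moderate_cutoff]), and the norm of [chi * g] is bounded by the seminorm of
    [g] on the support of [chi] ([cutoff_bound]) because the weighted norms are
    submultiplicative ([wnormM]).

    Submultiplicativity holds since the Fourier transform turns products into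
    convolutions and weights are subadditive. The convolution formula
    ([fourierM]) follows from Fourier inversion for continuous functions with
    compact support and integrable Fourier transform ([fourier_inversion]). This
    is proved by Abel summation: the factor [exp (- s (|eta_1| + ... + |eta_d|))]
    has a product of Poisson kernels as Fourier transform, and [s] tends to 0.
    Fubini's theorem and affine changes of variables on row vectors are obtained
    from the line by induction on the dimension. *)

Set Implicit Arguments.
Unset Strict Implicit.
Unset Printing Implicit Defensive.
Import Order.TTheory GRing.Theory Num.Theory.
Import numFieldNormedType.Exports.
Local Open Scope classical_set_scope.
Local Open Scope ring_scope.
Local Notation Re := complex.Re.
Local Notation Im := complex.Im.
Local Notation normc := Normc.normc.

(** * Weights dominated by a given weight *)
Section slope_inf.
Context {R : realType} (C : nat -> R).
Hypotheses (C_ge0 : forall n, 0 <= C n) (C0 : C 0 = 0).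

(** The lower envelope of lines with slopes tending to 0: concave, hence
    subadditive, and of sublinear growth because the slopes are arbitrarily
    small. Composed with a weight [w] it gives a weight below [w]. *)
Definition slope_inf (s : R) : R := inf (range (fun n => s / n.+1%:R + C n)).

Let lines_lbound s : has_lbound (range (fun n => s / n.+1%:R + C n)).
Proof.
exists (- `|s|) => _ [n _ <-]; rewrite -[X in X <= _]addr0 lerD// lerNl -mulNr.
rewrite (le_trans (ler_norm _))// normrM normrN ler_piMr//.
by rewrite ger0_norm// invf_le1// ler1n.
Qed.

Lemma slope_inf_le s n : slope_inf s <= s / n.+1%:R + C n.
Proof. by apply: ge_inf => //; exists n. Qed.

Lemma le_slope_inf s a : (forall n, a <= s / n.+1%:R + C n) -> a <= slope_inf s.
Proof.
move=> h; apply: lb_le_inf => [|_ [n _ <-]]; last exact: h.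
by exists (s / 1%:R + C 0); exists 0.
Qed.

Lemma slope_inf_le_id s : slope_inf s <= s.
Proof. by have := slope_inf_le s 0; rewrite C0 addr0 divr1. Qed.

Lemma slope_inf_ge0 s : 0 <= s -> 0 <= slope_inf s.
Proof. by move=> s0; apply: le_slope_inf => n; rewrite addr_ge0// divr_ge0. Qed.

Lemma slope_inf_nondecreasing : {homo slope_inf : s t / s <= t}.
Proof.
move=> s t st; apply: le_slope_inf => n; apply: le_trans (slope_inf_le s n) _.
by rewrite lerD2r ler_wpM2r.
Qed.

(** Bound [slope_inf (s + t)] by the flatter of any two lines chosen for [s] and
    for [t]: its intercept is paid once, and its slope is at most both. *)
Lemma slope_inf_subadditive s t : 0 <= s -> 0 <= t ->
  slope_inf (s + t) <= slope_inf s + slope_inf t.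
Proof.
move=> s0 t0; rewrite -lerBlDr; apply: le_slope_inf => n; rewrite lerBlDr.
rewrite -lerBlDl; apply: le_slope_inf => m; rewrite lerBlDl.
have key (a b : R) (i j : nat) : 0 <= b -> (j <= i)%N ->
    slope_inf (a + b) <= a / i.+1%:R + C i + (b / j.+1%:R + C j).
  move=> b0 ji; apply: le_trans (slope_inf_le _ i) _.
  rewrite mulrDl addrAC lerD2l -[leLHS]addr0 lerD//.
  by rewrite ler_wpM2l// lef_pV2 ?posrE// ler_nat.
have [nm|/ltnW mn] := leqP m n; first exact: key.
by rewrite addrC [leRHS]addrC; exact: key.
Qed.

Lemma slope_inf_lipschitz s t : slope_inf s <= slope_inf t + `|s - t|.
Proof.
rewrite -lerBlDr; apply: le_slope_inf => n; rewrite lerBlDr.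
apply: le_trans (slope_inf_le s n) _; rewrite addrAC lerD2r -lerBlDl -mulrBl.
rewrite (le_trans (ler_norm _))// normrM ler_piMr//.
by rewrite ger0_norm// invf_le1// ler1n.
Qed.

Lemma slope_inf_continuous : continuous slope_inf.
Proof.
move=> s; apply/cvgrPdist_le => e e0; near=> t.
have : `|s - t| <= e by near: t; apply: cvgr_dist_le.
apply: le_trans; rewrite ler_norml lerBlDl slope_inf_lipschitz andbT.
by rewrite lerBrDl lerBlDr distrC slope_inf_lipschitz.
Unshelve. all: by end_near. Qed.

Lemma slope_inf_littleo c : 0 < c ->
  exists S, forall s, S <= s -> slope_inf s <= c * s.
Proof.
move=> c0; have c20 : 0 < c / 2 by rewrite divr_gt0.
have [n] : exists n : nat, n.+1%:R^-1 <= c / 2.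
  exists (Num.truncn (c / 2)^-1); rewrite invf_ple ?posrE//.
  exact/ltW/truncnS_gt.
move=> nc; exists (Num.max 0 (C n / (c / 2))) => s.
rewrite ge_max => /andP[s0]; rewrite ler_pdivrMr// => Cs.
apply: le_trans (slope_inf_le s n) _; rewrite [c]splitr mulrDl lerD//.
  by rewrite mulrC ler_wpM2r.
by rewrite mulrC.
Qed.

End slope_inf.

Section weights.
Context {R : realType}.
Implicit Types w F : R -> R.

Lemma weight_ge0 w t : weight w -> 0 <= t -> 0 <= w t.
Proof. by move=> [[w0 _ _ _] _]; exact: w0. Qed.

Lemma weight_dvg w M : weight w -> \forall t \near +oo, M * ln (1 + t) <= w t.
Proof.
move=> [_ [_ _ /cvgryPge/(_ M)]] wM; near=> t.
have t0 : 0 < ln (1 + t).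
  by rewrite ln_gt0// ltrDl; near: t; exact: nbhs_pinfty_gt.
by rewrite -ler_pdivlMr//; near: t.
Unshelve. all: by end_near. Qed.

Lemma weight_cvgy w M : weight w -> \forall t \near +oo, M <= w t.
Proof.
move=> ww; near=> t; apply: (@le_trans _ _ (`|M| * ln (1 + t))); last first.
  by near: t; exact: weight_dvg.
rewrite (le_trans (ler_norm M))// ler_peMr// -[leLHS]expRK
  ler_ln ?posrE ?expR_gt0//.
  by rewrite -lerBlDl; near: t; exact: nbhs_pinfty_ge.
by rewrite ltr_wpDr//; near: t; exact: nbhs_pinfty_ge.
Unshelve. all: by end_near. Qed.

(** Integrability is inherited from [w] by [slope_inf_le_id]; continuity,
    monotonicity and subadditivity pass through the composition. *)
Lemma weight_slope_inf w (C : nat -> R) : weight w ->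
  (forall n, 0 <= C n) -> C 0 = 0 ->
  (forall M, \forall t \near +oo, M * ln (1 + t) <= slope_inf C (w t)) ->
  weight (slope_inf C \o w) /\ weight_ll (slope_inf C \o w) w.
Proof.
move=> ww C_ge0 C0 logC; case: (ww) => [[w0 wnd cw w00] [wD wI wln]].
have mw : measurable_fun (`[1, +oo[%classic : set R) w.
  apply: (@measurable_funS _ _ _ _ (`[0, +oo[%classic : set R)) => //.
    by apply: subset_itvr; rewrite bnd_simp.
  exact: subspace_continuous_measurable_fun.
have mpow : measurable_fun (`[1, +oo[%classic : set R)
    (fun t : R => (t ^+ 2)^-1).
  apply: subspace_continuous_measurable_fun => //.
  apply: continuous_in_subspaceT => x; rewrite inE/= in_itv/= andbT => x1.
  apply: (@continuousV R R (fun t => t ^+ 2) x).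
    by rewrite expf_neq0// gt_eqF// (lt_le_trans _ x1).
  exact: exprn_continuous.
split; last first.
  move=> c c0; have [S hS] := slope_inf_littleo C_ge0 c0.
  near=> t => /=.
  have wt0 : 0 <= w t by apply: w0; near: t; exact: nbhs_pinfty_ge.
  rewrite ger0_norm ?slope_inf_ge0// (ger0_norm wt0); apply: hS.
  by near: t; exact: weight_cvgy.
split; split => //=.
- by move=> x x0; rewrite slope_inf_ge0// w0.
- by move=> x y x0 xy; apply: slope_inf_nondecreasing => //; exact: wnd.
- move=> x; apply: (cvg_comp _ (slope_inf C) (cw x)).
  exact: slope_inf_continuous.
- by apply/eqP; rewrite eq_le w00 slope_inf_le_id// slope_inf_ge0.
- move=> x y x0 y0; apply: le_trans (slope_inf_subadditive _ _ _) => //.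
  + by apply: slope_inf_nondecreasing => //; exact: wD.
  + exact: w0.
  + exact: w0.
- apply: le_lt_trans wI; apply: ge0_le_integral => //.
  + move=> x /=; rewrite in_itv/= andbT => x1.
    rewrite lee_fin divr_ge0 ?sqr_ge0//= slope_inf_ge0// w0//.
    exact: le_trans x1.
  + apply/measurable_EFinP; apply: measurable_funM.
      apply: measurableT_comp.
        exact: (continuous_measurable_fun (slope_inf_continuous C_ge0)).
      exact: mw.
    exact: mpow.
  + apply/measurable_EFinP; apply: measurable_funM; [exact: mw|exact: mpow].
  + move=> x /=; rewrite in_itv/= andbT => x1;
      rewrite lee_fin ler_wpM2r ?invr_ge0 ?sqr_ge0//.
    exact: slope_inf_le_id.
- apply/cvgryPge => M; near=> t.
  rewrite ler_pdivlMr; first by near: t; exact: logC.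
  by rewrite ln_gt0// ltrDl; near: t; exact: nbhs_pinfty_gt.
Unshelve. all: by end_near. Qed.

(** Every [F] with [F = o(w)] is absorbed by a single weight [w1 << w]. The
    intercepts of the envelope are the values of [w] at the thresholds [T n] past
    which [F <= w / (n + 1)]: beyond [T n] the line of index [n] lies above [F] by
    its slope, before [T n] by its intercept. The geometric mean of [w] and
    [ln (1 + t)] is added to [F], as it is still [o(w)] but dominates every
    multiple of the logarithm and every constant. *)
Lemma weight_minorant w F : weight w ->
  (forall k, 0 < k -> \forall t \near +oo, F t <= k * w t) ->
  exists w1, [/\ weight w1, weight_ll w1 w &
    forall M, \forall t \near +oo, F t + M <= w1 t].
Proof.
move=> ww Fw; pose G t := Num.max 0 (F t) + Num.sqrt (w t * ln (1 + t)).
have Gw k : 0 < k -> \forall t \near +oo, G t <= k * w t.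
  move=> k0; have k20 : 0 < k / 2 by rewrite divr_gt0.
  have k2_ge0 := ltW k20.
  near=> t; have wt0 : 0 <= w t.
    by apply: weight_ge0 => //; near: t; exact: nbhs_pinfty_ge.
  rewrite [k]splitr mulrDl lerD//.
    rewrite ge_max (mulr_ge0 k2_ge0 wt0)/=; near: t; exact: Fw.
  rewrite -[leRHS](@ger0_norm _ (k / 2 * w t)) ?(mulr_ge0 k2_ge0 wt0)//.
  rewrite -sqrtr_sqr ler_wsqrtr// exprMn expr2 mulrA [w t * _]mulrC ler_wpM2r//.
  rewrite -ler_pdivrMl ?mulr_gt0//; near: t.
  exact: weight_dvg.
have /choice[T hT] (n : nat) : exists T, 0 <= T /\
    forall t, T <= t -> G t <= n.+1%:R^-1 * w t.
  have /Gw[T [_ hT]] : 0 < n.+1%:R^-1 :> R by rewrite invr_gt0.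
  exists (Num.max 0 (T + 1)); split=> [|t]; first by rewrite le_max lexx.
  rewrite ge_max => /andP[_] Tt; apply: hT.
  by rewrite (lt_le_trans _ Tt)// ltrDl.
pose C n := if n is 0 then 0 else w (T n).
have C_ge0 n : 0 <= C n.
  by case: n => [//|n]; apply: weight_ge0 => //; case: (hT n.+1).
have GC t : T 0 <= t -> G t <= slope_inf C (w t).
  move=> T0t; apply: le_slope_inf => n.
  have t0 : 0 <= t by apply: le_trans T0t; case: (hT 0).
  have [Tt|tT] := leP (T n) t.
    rewrite -[leLHS]addr0 lerD// mulrC; exact: (hT n).2.
  have := (hT 0).2 _ T0t; rewrite invr1 mul1r => Gt.
  rewrite (le_trans Gt)// -[leLHS]add0r lerD//.
    by rewrite divr_ge0// weight_ge0.
  case: n tT => [|n tT]; first by rewrite ltNge T0t.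
  by rewrite /C; case: ww => -[_ wnd _ _] _; apply: wnd => //; exact: ltW.
have logC M : \forall t \near +oo,
    F t + `|M| * ln (1 + t) <= slope_inf C (w t).
  near=> t; have T0t : T 0 <= t.
    by near: t; apply: nbhs_pinfty_ge; exact: num_real.
  apply: le_trans (GC _ T0t).
  have ln0 : 0 <= ln (1 + t).
    by rewrite ln_ge0// lerDl; near: t; exact: nbhs_pinfty_ge.
  rewrite lerD ?le_max ?lexx ?orbT//.
  rewrite -[leLHS](@ger0_norm _ (`|M| * _)) ?mulr_ge0//.
  rewrite -sqrtr_sqr ler_wsqrtr// exprMn [X in _ * X]expr2 mulrA ler_wpM2r//.
  by near: t; exact: weight_dvg.
have [] := @weight_slope_inf w C ww C_ge0 erefl.
  move=> M; near=> t.
  apply: (@le_trans _ _ (Num.sqrt (w t * ln (1 + t)))); last first.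
    have T0t : T 0 <= t.
      by near: t; apply: nbhs_pinfty_ge; exact: num_real.
    apply: le_trans (GC _ T0t).
    by rewrite lerDr le_max lexx.
  have ln0 : 0 <= ln (1 + t).
    by rewrite ln_ge0// lerDl; near: t; exact: nbhs_pinfty_ge.
  apply: (le_trans (ler_norm _)); rewrite -sqrtr_sqr ler_wsqrtr//.
  rewrite exprMn [X in _ * X]expr2 mulrA ler_wpM2r//.
  by near: t; exact: weight_dvg.
move=> ww1 w1w; exists (slope_inf C \o w); split=> // M.
near=> t; apply: (@le_trans _ _ (F t + `|M| * ln (1 + t))); last first.
  by near: t; exact: logC.
rewrite lerD2l (le_trans (ler_norm M))// ler_peMr//.
rewrite -[leLHS]expRK ler_ln ?posrE ?expR_gt0//.
  by rewrite -lerBlDl; near: t; exact: nbhs_pinfty_ge.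
by rewrite ltr_wpDr//; near: t; exact: nbhs_pinfty_ge.
Unshelve. all: by end_near. Qed.

Lemma measurable_weight_comp d (T : measurableType d) w (r : T -> R) :
  weight w -> (forall x, 0 <= r x) -> measurable_fun setT r ->
  measurable_fun setT (fun x => w (r x)).
Proof.
move=> [[_ nd _ _] _] r0 mr; pose s (t : R) := w (Num.max 0 t).
rewrite (_ : (fun x => _) = s \o r); last first.
  by apply/funext => x; rewrite /s/= max_r.
apply: measurableT_comp => //; apply: nondecreasing_measurable => // x y xy.
by apply: nd; [rewrite le_max lexx|rewrite ge_max !le_max lexx xy orbT].
Qed.

End weights.

(** * Integration of complex-valued functions *)
Section complex_numbers.
Context {R : realType}.
Implicit Types z : R[i].

Lemma ReM z1 z2 : Re (z1 * z2) = Re z1 * Re z2 - Im z1 * Im z2.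
Proof. by case: z1 z2 => ? ? []. Qed.
Lemma ImM z1 z2 : Im (z1 * z2) = Re z1 * Im z2 + Im z1 * Re z2.
Proof. by case: z1 z2 => ? ? []. Qed.

Lemma Re_realM (x : R) z : Re (x%:C%C * z) = x * Re z.
Proof. by rewrite ReM/= mul0r subr0. Qed.
Lemma Im_realM (x : R) z : Im (x%:C%C * z) = x * Im z.
Proof. by rewrite ImM/= mul0r addr0. Qed.

Lemma normcE z : normc z = Num.sqrt (Re z ^+ 2 + Im z ^+ 2).
Proof. by case: z. Qed.

Lemma normc_ge0 z : 0 <= normc z. Proof. by rewrite normcE sqrtr_ge0. Qed.

Lemma normc_real (x : R) : normc (x%:C)%C = `|x|.
Proof. by rewrite normcE /= expr0n addr0 sqrtr_sqr. Qed.

Lemma normr_Re_le z : `|Re z| <= normc z.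
Proof. by rewrite normcE -sqrtr_sqr ler_wsqrtr// lerDl sqr_ge0. Qed.

Lemma normr_Im_le z : `|Im z| <= normc z.
Proof. by rewrite normcE -sqrtr_sqr ler_wsqrtr// lerDr sqr_ge0. Qed.

Lemma normc_le z : normc z <= `|Re z| + `|Im z|.
Proof.
rewrite normcE -[leRHS]ger0_norm ?addr_ge0// -sqrtr_sqr ler_wsqrtr//.
by rewrite sqrrD !real_normK ?num_real// addrAC lerDl mulrn_wge0// mulr_ge0.
Qed.

Lemma expiD (s t : R) : expi (s + t) = expi s * expi t.
Proof.
apply/eqP; rewrite eq_complex /expi ReM ImM/= cosD sinD.
by rewrite eqxx/= addrC [_ * cos t]mulrC [cos s * _]mulrC eqxx.
Qed.

Lemma expi0 : expi (0 : R) = 1. Proof. by rewrite /expi cos0 sin0. Qed.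

Lemma normc_expi (t : R) : normc (expi t) = 1.
Proof. by rewrite normcE/= cos2Dsin2 sqrtr1. Qed.

End complex_numbers.

Section complex_measurability.
Context d (T : measurableType d) (R : realType).
Implicit Types f g : T -> R[i].

Definition cmeasurable f :=
  measurable_fun setT (fun x => Re (f x)) /\
  measurable_fun setT (fun x => Im (f x)).

Lemma cmeasurable_cst (z : R[i]) : cmeasurable (fun=> z).
Proof. by split; exact: measurable_cst. Qed.

Lemma cmeasurableM f g : cmeasurable f -> cmeasurable g ->
  cmeasurable (fun x => f x * g x).
Proof.
move=> [mRf mIf] [mRg mIg]; split.
- under eq_fun do rewrite ReM.
  by apply: measurable_funB; exact: measurable_funM.
- under eq_fun do rewrite ImM.
  by apply: measurable_funD; exact: measurable_funM.
Qed.

Lemma cmeasurable_real (f : T -> R) : measurable_fun setT f ->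
  cmeasurable (fun x => (f x)%:C%C).
Proof. by move=> mf; split => //; exact: measurable_cst. Qed.

Lemma cmeasurable_expi (f : T -> R) : measurable_fun setT f ->
  cmeasurable (fun x => expi (f x)).
Proof.
move=> mf; split; apply: measurableT_comp => //;
  apply: continuous_measurable_fun.
- exact: continuous_cos.
- exact: continuous_sin.
Qed.

Lemma measurable_normc f : cmeasurable f ->
  measurable_fun setT (fun x => normc (f x)).
Proof.
move=> [mR mI]; under eq_fun do rewrite normcE.
apply: (measurableT_comp (continuous_measurable_fun (@sqrt_continuous R))).
by apply: measurable_funD; exact: measurable_funX.
Qed.

End complex_measurability.

Lemma cmeasurable_comp d1 d2 (T1 : measurableType d1) (T2 : measurableType d2)
    (R : realType) (f : T2 -> R[i]) (h : T1 -> T2) :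
  cmeasurable f -> measurable_fun setT h -> cmeasurable (f \o h).
Proof.
by move=> [mR mI] mh; split;
  [exact: (measurableT_comp mR)|exact: (measurableT_comp mI)].
Qed.

Section complex_integral.
Context d (T : measurableType d) (R : realType).
Variable mu : {measure set T -> \bar R}.
Implicit Types f g : T -> R[i].

Definition cint f : R[i] :=
  (Rintegral mu setT (fun x => Re (f x)) +i*
   Rintegral mu setT (fun x => Im (f x)))%C.

Definition cintegrable f :=
  mu.-integrable setT (fun x => (Re (f x))%:E) /\
  mu.-integrable setT (fun x => (Im (f x))%:E).

Lemma eq_cint f g : f =1 g -> cint f = cint g.
Proof. by move=> /funext ->. Qed.

Lemma cintegrable_measurable f : cintegrable f -> cmeasurable f.
Proof.
by move=> [/measurable_int mR /measurable_int mI]; split;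
  exact/measurable_EFinP.
Qed.

Lemma dominated_cintegrable f (g : T -> R) : cmeasurable f ->
  mu.-integrable setT (EFin \o g) -> (forall x, normc (f x) <= g x) ->
  cintegrable f.
Proof.
move=> [mR mI] ig fg; split; apply: le_integrable ig => //=.
- exact/measurable_EFinP.
- move=> x _; rewrite lee_fin (le_trans (normr_Re_le _))// (le_trans (fg x))//.
  exact: ler_norm.
- exact/measurable_EFinP.
- move=> x _; rewrite lee_fin (le_trans (normr_Im_le _))// (le_trans (fg x))//.
  exact: ler_norm.
Qed.

Lemma integrable_normc f : cintegrable f ->
  mu.-integrable setT (fun x => (normc (f x))%:E).
Proof.
move=> cf; have [iR iI] := cf.
have iRI := integrableD measurableT (integrable_abse iR) (integrable_abse iI).
apply: le_integrable iRI => //=.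
  exact/measurable_EFinP/measurable_normc/cintegrable_measurable.
move=> x _; rewrite !lee_fin ger0_norm ?normc_ge0//
  [leRHS]ger0_norm ?addr_ge0//.
exact: normc_le.
Qed.

Lemma cintegrableP f : cmeasurable f ->
  cintegrable f <-> (\int[mu]_x (normc (f x))%:E < +oo)%E.
Proof.
move=> mf; split=> [/integrable_normc/integrableP[_]|foo].
  by under eq_integral => x _ do rewrite /= ger0_norm ?normc_ge0//.
apply: (@dominated_cintegrable _ (fun x => normc (f x))) => //.
apply/integrableP; split; first exact/measurable_EFinP/measurable_normc.
by under eq_integral => x _ do rewrite /= ger0_norm ?normc_ge0//.
Qed.

Lemma cintZl a f : cintegrable f -> cint (fun x => a * f x) = a * cint f.
Proof.
move=> [iR iI]; case: a => a b; rewrite /cint.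
have iZ (c : R) (h : T -> R) : mu.-integrable setT (fun x => (h x)%:E) ->
    mu.-integrable setT (EFin \o (fun x => c * h x)).
  by move=> ih; under [X in _.-integrable _ X]eq_fun do rewrite /= EFinM;
     exact: integrableZl.
apply/eqP; rewrite eq_complex ReM ImM/=; apply/andP; split; apply/eqP.
- under eq_Rintegral do rewrite ReM/=.
  by rewrite RintegralB//; [rewrite !RintegralZl|exact: iZ|exact: iZ].
- under eq_Rintegral do rewrite ImM/=.
  by rewrite RintegralD//; [rewrite !RintegralZl|exact: iZ|exact: iZ].
Qed.

Lemma cintegrableZl a f : cintegrable f -> cintegrable (fun x => a * f x).
Proof.
move=> cf; apply: (@dominated_cintegrable _ (fun x => normc a * normc (f x))).
- apply: cmeasurableM; first exact: cmeasurable_cst.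
  exact: cintegrable_measurable.
- under [X in _.-integrable _ X]eq_fun do rewrite /= EFinM.
  exact/integrableZl/integrable_normc.
- by move=> x; rewrite Normc.normcM.
Qed.

(** Rotate the integral onto the positive real axis by a unit [u]; its modulus
    is then the integral of [Re (u * f) <= |f|]. *)
Lemma le_normc_cint f : cintegrable f ->
  ((normc (cint f))%:E <= \int[mu]_x (normc (f x))%:E)%E.
Proof.
move=> cf; set z := cint f.
have nf := integrable_normc cf.
have [z0|z0] := eqVneq (normc z) 0.
  by rewrite z0 integral_ge0// => x _; rewrite lee_fin normc_ge0.
pose u := (normc z)^-1%:C%C * (z^*)%C.
have nu : normc u = 1.
  rewrite Normc.normcM normc_real [X in _ * X](_ : _ = normc z).
    by rewrite ger0_norm ?invr_ge0 ?normc_ge0// mulVf.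
  by case: (z) => a b; rewrite !normcE/= sqrrN.
have uz : Re (u * z) = normc z.
  rewrite -mulrA Re_realM.
  have -> : Re (z^* * z)%C = normc z ^+ 2.
    by case: (z) => a b; rewrite ReM normcE/= sqr_sqrtr ?addr_ge0 ?sqr_ge0//;
      ring.
  by rewrite expr2 mulrA mulVf// mul1r.
rewrite -uz -cintZl//= -[leRHS]fineK ?integrable_fin_num//.
rewrite lee_fin; apply: le_Rintegral => //.
  exact: (cintegrableZl u cf).1.
move=> x _; rewrite -[leRHS]mul1r -nu -Normc.normcM.
exact: le_trans (ler_norm _) (normr_Re_le _).
Qed.

End complex_integral.

(** [Rintegral] takes the finite part of the inner integral, which is infinite
    on a null set at most; hence the almost-everywhere step in both proofs. *)
Section real_fubini.
Context d1 d2 (T1 : measurableType d1) (T2 : measurableType d2) (R : realType).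
Variables (m1 : {sigma_finite_measure set T1 -> \bar R}).
Variables (m2 : {sigma_finite_measure set T2 -> \bar R}).
Variable f : T1 * T2 -> R.
Hypothesis intf : (m1 \x m2)%E.-integrable setT (EFin \o f).

Lemma Rintegral12_prod :
  Rintegral m1 setT (fun x => Rintegral m2 setT (fun y => f (x, y))) =
  Rintegral (m1 \x m2)%E setT f.
Proof.
rewrite /Rintegral; congr fine; rewrite -(integral12_prod_meas1 intf).
have mF := measurable_fubini_F intf.
apply: ae_eq_integral => //.
  apply/measurable_EFinP; exact: measurableT_comp mF.
have := ae_integrable1 intf; apply: filterS => x ix _.
by rewrite fineK//; exact: integrable_fin_num.
Qed.

Lemma Rintegral21_prod :
  Rintegral m2 setT (fun y => Rintegral m1 setT (fun x => f (x, y))) =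
  Rintegral (m1 \x m2)%E setT f.
Proof.
rewrite /Rintegral; congr fine; rewrite -(integral21_prod_meas1 intf).
have mG := measurable_fubini_G intf.
apply: ae_eq_integral => //.
  apply/measurable_EFinP; exact: measurableT_comp mG.
have := ae_integrable2 intf; apply: filterS => x ix _.
by rewrite fineK//; exact: integrable_fin_num.
Qed.

End real_fubini.

Section complex_fubini.
Context d1 d2 (T1 : measurableType d1) (T2 : measurableType d2) (R : realType).
Variables (m1 : {sigma_finite_measure set T1 -> \bar R}).
Variables (m2 : {sigma_finite_measure set T2 -> \bar R}).
Implicit Type f : T1 * T2 -> R[i].

Lemma cint12_prod f : cintegrable (m1 \x m2)%E f ->
  cint m1 (fun x => cint m2 (fun y => f (x, y))) = cint (m1 \x m2)%E f.
Proof.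
move=> [iR iI]; rewrite /cint/=.
by rewrite (Rintegral12_prod iR) (Rintegral12_prod iI).
Qed.

Lemma cint21_prod f : cintegrable (m1 \x m2)%E f ->
  cint m2 (fun y => cint m1 (fun x => f (x, y))) = cint (m1 \x m2)%E f.
Proof.
move=> [iR iI]; rewrite /cint/=.
by rewrite (Rintegral21_prod iR) (Rintegral21_prod iI).
Qed.

Lemma cFubini f : cintegrable (m1 \x m2)%E f ->
  cint m1 (fun x => cint m2 (fun y => f (x, y))) =
  cint m2 (fun y => cint m1 (fun x => f (x, y))).
Proof. by move=> cf; rewrite cint12_prod// cint21_prod. Qed.

Lemma cintegrable_prod (f : T1 -> R[i]) (g : T2 -> R[i]) :
  cintegrable m1 f -> cintegrable m2 g ->
  cintegrable (m1 \x m2)%E (fun p => f p.1 * g p.2).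
Proof.
move=> cf cg.
have mf := cintegrable_measurable cf; have mg := cintegrable_measurable cg.
have mfg : cmeasurable (fun p : T1 * T2 => f p.1 * g p.2).
  apply: cmeasurableM; first exact: (cmeasurable_comp mf measurable_fst).
  exact: (cmeasurable_comp mg measurable_snd).
apply/cintegrableP => //; rewrite fubini_tonelli1//=; last first.
- by move=> x; rewrite lee_fin normc_ge0.
- exact/measurable_EFinP/measurable_normc.
rewrite /fubini_F/=.
under eq_integral => x _.
  under eq_integral => y _ do rewrite Normc.normcM EFinM.
  rewrite ge0_integralZl//; last 3 first.
  - exact/measurable_EFinP/measurable_normc.
  - by move=> y _; rewrite lee_fin normc_ge0.
  - by rewrite lee_fin normc_ge0.
  over.
rewrite ge0_integralZr//; last 3 first.
- exact/measurable_EFinP/measurable_normc.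
- by move=> y _; rewrite lee_fin normc_ge0.
- by apply: integral_ge0 => x _; rewrite lee_fin normc_ge0.
by rewrite lte_mul_pinfty ?integral_ge0//; [move=> x _;
  rewrite lee_fin normc_ge0
  | exact: integrable_fin_num (integrable_normc cf) | exact/cintegrableP].
Qed.

Lemma cint_prod (f : T1 -> R[i]) (g : T2 -> R[i]) :
  cintegrable m1 f -> cintegrable m2 g ->
  cint (m1 \x m2)%E (fun p => f p.1 * g p.2) = cint m1 f * cint m2 g.
Proof.
move=> cf cg; rewrite -cint12_prod//=; last exact: cintegrable_prod.
rewrite (@eq_cint _ _ _ _ _ (fun x => cint m2 g * f x)).
  by rewrite cintZl// mulrC.
by move=> x; rewrite cintZl// mulrC.
Qed.

End complex_fubini.

(** * Lebesgue integration on row vectors *)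
Section rV_measurability.
Context {R : realType} (n : nat).
Local Notation Rn := 'rV[R]_n.

(** The sigma-algebra is generated by the coordinates; an open set is the
    countable union of the boxes with rational centre and radius [1 / (k + 1)]
    which it contains. *)
Lemma open_measurable_rV (A : set Rn) : open A -> measurable A.
Proof.
move=> oA.
pose box (p : 'rV[rat]_n * nat) : set Rn :=
  [set x | forall i, `|x ord0 i - ratr (p.1 ord0 i)| < p.2.+1%:R^-1].
have mbox p : measurable (box p).
  rewrite (_ : box p = \bigcap_(i in [set: 'I_n])
      (fun v : Rn => v ord0 i) @^-1`
      [set t | `|t - ratr (p.1 ord0 i)| < p.2.+1%:R^-1]).
    apply: fin_bigcap_measurable => // i _.
    rewrite -[X in measurable X]setTI; apply: (measurable_coord i) => //.
    pose c : R := ratr (p.1 ord0 i); pose r : R := p.2.+1%:R^-1.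
    rewrite (_ : [set t | _] = `]c - r, c + r[%classic);
      first exact: measurable_itv.
    by apply/seteqP; split => t; rewrite /= in_itv/= ltr_distl.
  apply/seteqP; split => x /=; first by move=> h i _; exact: h.
  by move=> h i; exact: h.
rewrite (_ : A = \bigcup_p (if `[< box p `<=` A >] then box p else set0)).
  apply: countable_bigcupT_measurable => [|p]; first exact: countableP.
  by case: ifP.
apply/seteqP; split=> [x Ax|x [p _]]; last by case: asboolP => // pA /pA.
have /nbhs_ballP[e /= e0 eA] : nbhs x A by exact: open_nbhs_nbhs.
have [k ke] : exists k : nat, k.+1%:R^-1 < e / 2.
  exists (Num.truncn (e / 2)^-1).
  rewrite invf_plt ?posrE// ?truncnS_gt//.
  by rewrite divr_gt0.
have /choice[q hq] (i : 'I_n) :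
    exists q : rat, `|x ord0 i - ratr q| < k.+1%:R^-1.
  have [|q] := @rat_in_itvoo R (x ord0 i - k.+1%:R^-1) (x ord0 i + k.+1%:R^-1).
    by rewrite ltrBlDr -addrA ltrDl addr_gt0.
  by rewrite in_itv/= => xq; exists q; rewrite distrC ltr_distl.
exists (\row_i q i, k) => //; case: asboolP => [_ i|]; first by rewrite /= mxE.
move=> nA; exfalso; apply: nA => y /= yq; apply: eA; split=> // i j;
  rewrite (ord1 i).
have := hq j; have := yq j; rewrite mxE /ball/= => yj xj.
rewrite (le_lt_trans (ler_distD (ratr (q j)) _ _))// [e]splitr ltrD//.
  exact: lt_trans ke.
by rewrite distrC; exact: lt_trans ke.
Qed.

Lemma continuous_measurable_fun_rV (f : Rn -> R) :
  continuous f -> measurable_fun setT f.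
Proof.
move=> /continuousP cf; apply: (measurability _ (RGenOpens.measurableE R)).
move=> _ [_ [a [b ->] <-]]; rewrite setTI; apply: open_measurable_rV.
exact/cf/interval_open.
Qed.

Lemma ccontinuous_measurable (f : Rn -> R[i]) : ccontinuous f -> cmeasurable f.
Proof. by move=> [cR cI]; split; exact: continuous_measurable_fun_rV. Qed.

Lemma measurable_dot d (T : measurableType d) (f g : T -> Rn) :
  measurable_fun setT f -> measurable_fun setT g ->
  measurable_fun setT (fun x => dot (f x) (g x)).
Proof.
move=> mf mg; apply: measurable_sum => i; apply: measurable_funM.
- exact: (measurableT_comp (measurable_coord i) mf).
- exact: (measurableT_comp (measurable_coord i) mg).
Qed.

Lemma measurable_affine_rV (a : Rn) (s : R) :
  measurable_fun setT (fun x : Rn => a + s *: x).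
Proof.
apply: measurable_fun_rV => i; under eq_fun do rewrite !mxE.
by apply: measurable_funD => //; apply: measurable_funM => //;
  exact: measurable_coord.
Qed.

End rV_measurability.

(** Both sides integrate [f], against [|s|] times the image measure and against
    Lebesgue measure; these agree on half-open intervals. *)
Lemma lebesgue_affine (R : realType) (a s : R) (f : R -> \bar R) : s != 0 ->
  measurable_fun setT f -> (forall x, 0 <= f x)%E ->
  (`|s|%:E * \int[lebesgue_measure]_x f (a + s * x)%R =
   \int[lebesgue_measure]_x f x)%E.
Proof.
move=> s0 mf f0.
pose phi : measurableTypeR R -> measurableTypeR R := fun x => a + s * x.
have mphi : measurable_fun setT phi.
  by apply: measurable_funD => //; exact: measurable_funM.
pose pm : {measure set (measurableTypeR R) -> \bar R} :=
  pushforward lebesgue_measure phi.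
have E := @ge0_integral_pushforward _ _ _ _ _ phi mphi lebesgue_measure setT f
  measurableT mf (fun x _ => f0 x).
rewrite preimage_setT in E.
pose k : {nonneg R} := NngNum (normr_ge0 s).
transitivity (k%:num%:E * \int[pm mphi]_x f x)%E; first by congr (_ * _)%E.
rewrite -ge0_integral_mscale//.
symmetry; apply: eq_measure_integral => A mA _.
apply: lebesgue_measure_unique mA => // X /ocitvP[->|[[c d] /= cd ->]].
  by rewrite !measure0.
rewrite [RHS]/mscale/= /pushforward lebesgue_measure_itv/= lte_fin cd -EFinD.
have [sp|sn] := ltP 0 s.
  rewrite (_ : phi @^-1` _ = `](c - a) / s, (d - a) / s]%classic).
    rewrite lebesgue_measure_itv/= lte_fin ltr_pM2r ?invr_gt0// ltrD2r cd.
    rewrite -EFinD -EFinM gtr0_norm//; congr EFin; field; exact: lt0r_neq0.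
  apply/seteqP; split => x; rewrite /phi /= !in_itv/=.
    by rewrite ltr_pdivrMr// ler_pdivlMr// ltrBlDl lerBrDl [x * s]mulrC.
  by rewrite ltr_pdivrMr// ler_pdivlMr// ltrBlDl lerBrDl [x * s]mulrC.
have {}sn : s < 0 by rewrite lt_neqAle s0.
rewrite (_ : phi @^-1` _ = `[(d - a) / s, (c - a) / s[%classic).
  rewrite lebesgue_measure_itv/= lte_fin ltr_nM2r ?invr_lt0// ltrD2r cd.
  rewrite -EFinD -EFinM ltr0_norm//; congr EFin; field; exact: ltr0_neq0.
apply/seteqP; split => x; rewrite /phi /= !in_itv/= andbC.
  by rewrite ler_ndivrMr// ltr_ndivlMr// ltrBlDl lerBrDl [x * s]mulrC.
by rewrite ltr_ndivlMr// ler_ndivrMr// ltrBlDl lerBrDl [x * s]mulrC.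
Qed.

Lemma cmeasurable_prod d (T : measurableType d) (R : realType) (I : Type)
    (s : seq I) (f : I -> T -> R[i]) : (forall i, cmeasurable (f i)) ->
  cmeasurable (fun x => \prod_(i <- s) f i x).
Proof.
move=> mf; elim: s => [|i s IHs].
  by under eq_fun do rewrite big_nil; exact: cmeasurable_cst.
by under eq_fun do rewrite big_cons; exact: cmeasurableM.
Qed.

Section rV_integral.
Context {R : realType}.

Lemma measurable_leb_coord n (i : 'I_n) :
  measurable_fun setT (fun x : 'rV[R]_n => x ord0 i : measurableTypeR R).
Proof. exact: measurable_coord. Qed.

(** The map [rV_cons], with its first factor typed by the copy of the reals that
    carries the sigma-algebra of [lebesgue_measure]. *)
Definition leb_cons n : measurableTypeR R * 'rV[R]_n -> 'rV[R]_n.+1 :=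
  @rV_cons _ R n.

Lemma measurable_leb_cons n : measurable_fun setT (@leb_cons n).
Proof. exact: measurable_rV_cons. Qed.

Lemma ge0_integral_leb_cons n (f : 'rV[R]_n.+1 -> \bar R) :
  measurable_fun setT f -> (forall x, 0 <= f x)%E ->
  (\int[lebesgue_rV n.+1]_x f x =
   \int[lebesgue_measure \x lebesgue_rV n]_p f (leb_cons p))%E.
Proof.
move=> mf f0.
have := @ge0_integral_pushforward _ _ _ _ _ (@leb_cons n)
  (@measurable_leb_cons n) (lebesgue_measure \x lebesgue_rV n)%E setT f
  measurableT mf (fun x _ => f0 x).
rewrite preimage_setT => E.
exact: E.
Qed.

Lemma ge0_integral_rV_cons n (f : 'rV[R]_n.+1 -> \bar R) :
  measurable_fun setT f -> (forall x, 0 <= f x)%E ->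
  (\int[lebesgue_rV n.+1]_x f x =
   \int[lebesgue_measure]_x \int[lebesgue_rV n]_y f (leb_cons (x, y)))%E.
Proof.
move=> mf f0; rewrite ge0_integral_leb_cons// fubini_tonelli1//.
by apply: measurableT_comp => //; exact: measurable_leb_cons.
Qed.

Lemma integrable_leb_cons n (f : 'rV[R]_n.+1 -> \bar R) :
  measurable_fun setT f ->
  (lebesgue_measure \x lebesgue_rV n)%E.-integrable setT (f \o @leb_cons n) ->
  (lebesgue_rV n.+1).-integrable setT f.
Proof.
move=> mf /integrableP[_ fi]; apply/integrableP; split => //.
by rewrite ge0_integral_leb_cons//; exact: measurableT_comp.
Qed.

Lemma integral_leb_cons n (f : 'rV[R]_n.+1 -> \bar R) :
  measurable_fun setT f ->
  (\int[lebesgue_rV n.+1]_x f x =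
   \int[lebesgue_measure \x lebesgue_rV n]_p f (leb_cons p))%E.
Proof.
move=> mf; rewrite [LHS]integralE [RHS]integralE; congr (_ - _)%E.
  rewrite ge0_integral_leb_cons//; last exact: measurable_funepos.
  apply: eq_integral => p _.
  by rewrite -[LHS]/((f^\+ \o @leb_cons n)%E p) -funepos_comp.
rewrite ge0_integral_leb_cons//; last exact: measurable_funeneg.
apply: eq_integral => p _.
by rewrite -[LHS]/((f^\- \o @leb_cons n)%E p) -funeneg_comp.
Qed.

Lemma cintegrable_leb_cons n (f : 'rV[R]_n.+1 -> R[i]) : cmeasurable f ->
  cintegrable (lebesgue_measure \x lebesgue_rV n)%E (f \o @leb_cons n) ->
  cintegrable (lebesgue_rV n.+1) f.
Proof.
by move=> [mR mI] [iR iI]; split; apply: integrable_leb_cons => //;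
  exact/measurable_EFinP.
Qed.

Lemma cint_leb_cons n (f : 'rV[R]_n.+1 -> R[i]) : cmeasurable f ->
  cint (lebesgue_rV n.+1) f =
  cint (lebesgue_measure \x lebesgue_rV n)%E (f \o @leb_cons n).
Proof.
move=> [mR mI]; rewrite /cint /Rintegral; congr (fine _ +i* fine _)%C.
- by rewrite integral_leb_cons//; exact/measurable_EFinP.
- by rewrite integral_leb_cons//; exact/measurable_EFinP.
Qed.

(** Induction on the dimension, one coordinate at a time, by Tonelli. *)
Lemma lebesgue_rV_affine n (a : 'rV[R]_n) (s : R) (f : 'rV[R]_n -> \bar R) :
  s != 0 -> measurable_fun setT f -> (forall x, 0 <= f x)%E ->
  ((`|s| ^+ n)%:E * \int[lebesgue_rV n]_x f (a + s *: x)%R =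
   \int[lebesgue_rV n]_x f x)%E.
Proof.
move=> s0; elim: n a f => [|n IHn] a f mf f0.
  rewrite expr0 mul1e; apply: eq_integral => x _; congr f.
  by rewrite [LHS]thinmx0 [RHS]thinmx0.
rewrite !ge0_integral_rV_cons//; last first.
  by apply: measurableT_comp => //; exact: measurable_affine_rV.
pose a' : 'rV[R]_n := \row_i a ord0 (lift ord0 i).
have consE x y : a + s *: leb_cons (x, y) =
    leb_cons (a ord0 ord0 + s * x, a' + s *: y).
  apply/rowP => i; rewrite !mxE/=; case: unliftP => [j ->|->] /=;
    rewrite ?mxE//.
under eq_integral => x _ do under eq_integral => y _ do rewrite consE.
pose g x := (\int[lebesgue_rV n]_y f (leb_cons (x, y)))%E.
have mfc : measurable_fun setT (f \o @leb_cons n).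
  by apply: measurableT_comp => //; exact: measurable_leb_cons.
have mg : measurable_fun setT g.
  exact: (measurable_fun_fubini_tonelli_F (f \o @leb_cons n) mfc (fun=> f0 _)).
have g0 x : (0 <= g x)%E by exact: integral_ge0.
have sn0 : `|s| ^+ n != 0 by rewrite expf_neq0// normr_eq0.
have hE x :
    (\int[lebesgue_rV n]_y f (leb_cons (a ord0 ord0 + s * x, a' + s *: y))%R =
    ((`|s| ^+ n)^-1)%:E * g (a ord0 ord0 + s * x)%R)%E.
  rewrite /g -(IHn a' (fun y => f (leb_cons (_, y))))//; last first.
    exact: (measurableT_comp mfc (pair1_measurable _)).
  by rewrite muleA -EFinM mulVf// mul1e.
under eq_integral => x _ do rewrite hE.
rewrite ge0_integralZl//; last first.
  apply: (measurableT_comp mg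
    (g := fun x : measurableTypeR R => a ord0 ord0 + s * x)).
  by apply: measurable_funD => //; exact: measurable_funM.
rewrite muleA -EFinM exprSr [_ * `|s|]mulrC -mulrA mulfV// mulr1.
exact: lebesgue_affine.
Qed.

Lemma integral_rV0 (f : 'rV[R]_0 -> \bar R) :
  (\int[lebesgue_rV 0]_x f x = f 0%R)%E.
Proof.
have -> : f = cst (f 0) by apply/funext => x; rewrite [x]thinmx0.
transitivity (f 0%R * lebesgue_rV 0 [set: 'rV[R]_0])%E.
  exact: (integral_cst (lebesgue_rV 0) measurableT).
have -> : lebesgue_rV 0 [set: 'rV[R]_0] = 1%E by exact: diracT.
by rewrite mule1.
Qed.

(** Integrals of tensor products factor. This reduces the two kernels of the
    inversion formula to integrals over the line. *)
Lemma cint_tensor n (f : 'I_n -> R -> R[i]) :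
  (forall i, cintegrable lebesgue_measure (f i)) ->
  cintegrable (lebesgue_rV n) (fun x => \prod_i f i (x ord0 i)) /\
  cint (lebesgue_rV n) (fun x => \prod_i f i (x ord0 i)) =
  \prod_i cint lebesgue_measure (f i).
Proof.
elim: n f => [|n IHn] f fi.
  under eq_fun do rewrite big_ord0.
  split; last by rewrite big_ord0 /cint /Rintegral !integral_rV0.
  split; apply/integrableP; split=> //; rewrite integral_rV0 ltry//.
have [IHi IHe] := IHn (fun i => f (lift ord0 i)) (fun i => fi _).
pose F (x : 'rV[R]_n.+1) := \prod_i f i (x ord0 i).
have mF : cmeasurable F.
  apply: cmeasurable_prod => i.
  have mfi := cintegrable_measurable (fi i).
  exact: cmeasurable_comp mfi (@measurable_leb_coord n.+1 i).
have FE : F \o @leb_cons n = fun p => f ord0 p.1 *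
    \prod_(i < n) f (lift ord0 i) (p.2 ord0 i).
  apply/funext => -[x y]; rewrite /F /= big_ord_recl; congr (_ * _).
    by rewrite mxE unlift_none.
  by apply: eq_bigr => i _; rewrite mxE liftK.
have iF : cintegrable (lebesgue_measure \x lebesgue_rV n)%E (F \o @leb_cons n).
  by rewrite FE; exact: (cintegrable_prod (fi ord0) IHi).
split; first exact: cintegrable_leb_cons.
by rewrite cint_leb_cons// FE big_ord_recl -IHe -cint_prod.
Qed.

End rV_integral.

(** * The Fourier transform of exp(-|t|) *)
Section one_dimensional_kernel.
Context {R : realType}.
Implicit Types y t : R.
Notation mu := (@lebesgue_measure R).

Let prim y t : R :=
  expR (- t) * (-1 + (y * sin (y * t) - cos (y * t)) / (1 + y ^+ 2)).
Let dens y t : R := expR (- t) * (1 + cos (y * t)).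

Let oneDsqr_gt0 y : 0 < 1 + y ^+ 2.
Proof. by rewrite ltr_pwDl// sqr_ge0. Qed.

Let is_derive_prim y t : is_derive t 1 (prim y) (dens y t).
Proof.
have dl (a : R) : is_derive t 1 (fun x => a * x) a.
  by apply: is_derive_eq; rewrite /GRing.scale/= !mulr1.
have ds : is_derive t 1 (fun x => sin (y * x)) (cos (y * t) * y).
  exact: (is_derive1_comp (is_derive_sin _) (dl y)).
have dc : is_derive t 1 (fun x => cos (y * x)) (- sin (y * t) * y).
  exact: (is_derive1_comp (is_derive_cos _) (dl y)).
have de : is_derive t 1 (fun x => expR (- x)) (expR (- t) * -1).
  apply: (@is_derive1_comp _ expR -%R).
have dg : is_derive t 1
    (fun x => -1 + (y * sin (y * x) - cos (y * x)) / (1 + y ^+ 2))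
    ((y * (cos (y * t) * y) + sin (y * t) * y) / (1 + y ^+ 2)).
  have dcst (c : R) := @is_derive_cst R R R c t 1.
  have dquo := is_deriveM (is_deriveB (is_deriveM (dcst y) ds) dc)
    (dcst (1 + y ^+ 2)^-1).
  apply: (is_derive_eq (is_deriveD (dcst (-1)) dquo)); rewrite /GRing.scale/=.
  by rewrite !(mul0r,mulr0,add0r,addr0,mulr1,mulNr,opprK) mulrC.
apply: (is_derive_eq (is_deriveM de dg)).
have := oneDsqr_gt0 y; rewrite /dens /GRing.scale/= => h.
by field; rewrite gt_eqF.
Qed.

Let prim_cvg0 y : prim y t @[t --> +oo] --> 0.
Proof.
pose C : R := 1 + (`|y| + 1) / (1 + y ^+ 2).
apply: (@squeeze_cvgr _ _ _ _ (fun t => - (expR (- t) * C))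
  (fun t => expR (- t) * C)).
- apply: nearW => t; rewrite -ler_norml normrM ger0_norm ?expR_ge0//.
  rewrite ler_wpM2l ?expR_ge0// (le_trans (ler_normD _ _))// normrN1 lerD2l.
  have k0 : 0 <= (1 + y ^+ 2)^-1 by rewrite invr_ge0 ltW.
  rewrite normrM (ger0_norm k0) ler_wpM2r//.
  rewrite (le_trans (ler_normB _ _))// lerD//.
    by rewrite normrM ler_piMr// ler_norml sin_geN1 sin_le1.
  by rewrite ler_norml cos_geN1 cos_le1.
- rewrite -oppr0 -[in X in _ --> X](mul0r C).
  by apply: cvgN; apply: cvgM; [exact: cvgr_expR|exact: cvg_cst].
- rewrite -[in X in _ --> X](mul0r C).
  by apply: cvgM; [exact: cvgr_expR|exact: cvg_cst].
Qed.

Let cdens y : continuous (dens y).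
Proof.
move=> t; rewrite /continuous_at /dens; apply: cvgM.
  by apply: (@continuous_comp _ _ _ -%R expR);
    [exact: continuousN|exact: continuous_expR].
apply: cvgD; first exact: cvg_cst.
by apply: (@continuous_comp _ _ _ ( *%R y) cos);
  [exact: mulrl_continuous|exact: continuous_cos].
Qed.

(** The summand 1 makes the integrand nonnegative, so that the fundamental
    theorem of calculus on a half-line applies with the primitive [prim]. *)
Lemma integral_expRN_cos y :
  (\int[mu]_(t in `[0%R, +oo[) (expR (- t) * (1 + cos (y * t)))%:E =
   (1 + (1 + y ^+ 2)^-1)%:E)%E.
Proof.
rewrite (@ge0_continuous_FTC2y _ (dens y) (prim y) 0 0).
- rewrite -EFinB /prim; congr EFin.
  by rewrite mulr0 oppr0 expR0 sin0 cos0; ring.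
- by move=> t _; rewrite /dens mulr_ge0 ?expR_ge0// -lerBlDl sub0r cos_geN1.
- by apply: continuous_subspaceT; exact: cdens.
- exact: prim_cvg0.
- by move=> t _; have := is_derive_prim y t => -[].
- apply: cvg_at_right_filter; apply: differentiable_continuous.
  by apply/derivable1_diffP; have := is_derive_prim y 0 => -[].
- by move=> t _; rewrite derive1E; have := is_derive_prim y t => -[].
Qed.

Lemma continuous_measurable_leb (f : R -> R) : continuous f ->
  measurable_fun setT (f : measurableTypeR R -> R).
Proof. exact: continuous_measurable_fun. Qed.

Let sexp t : R := expR (- `|t|).

Let sexp_ge0 t : 0 <= sexp t. Proof. exact: expR_ge0. Qed.

Let continuous_sexp : continuous sexp.
Proof.
move=> t; apply: (@continuous_comp _ _ _ (fun t => - `|t|) expR);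
  last exact: continuous_expR.
by apply: cvgN; exact: norm_continuous.
Qed.

Let continuous_sexp_cos y : continuous (fun t => sexp t * (1 + cos (y * t))).
Proof.
move=> t; rewrite /continuous_at; apply: cvgM; first exact: continuous_sexp.
apply: cvgD; first exact: cvg_cst.
by apply: (@continuous_comp _ _ _ ( *%R y) cos);
  [exact: mulrl_continuous|exact: continuous_cos].
Qed.

Let integral_sexp_cos y :
  (\int[mu]_t (sexp t * (1 + cos (y * t)))%:E =
   (2 * (1 + (1 + y ^+ 2)^-1))%:E)%E.
Proof.
rewrite (ge0_symfun_integralT _ (@continuous_sexp_cos y)); last 2 first.
- by move=> t; rewrite mulr_ge0// -lerBlDl sub0r cos_geN1.
- by move=> t; rewrite /sexp/= normrN mulrN cosN.
rewrite EFinM -integral_expRN_cos -set_itvcy; congr (_ * _)%E.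
by apply: eq_integral => t; rewrite inE/= in_itv/= andbT => t0;
  rewrite /sexp ger0_norm.
Qed.

Let integrable_sexp_cos y :
  mu.-integrable setT (EFin \o (fun t => sexp t * (1 + cos (y * t)))).
Proof.
apply/integrableP; split.
  apply/measurable_EFinP.
  exact: (continuous_measurable_leb (@continuous_sexp_cos y)).
under eq_integral => t _.
  rewrite /= ger0_norm; last by rewrite mulr_ge0// -lerBlDl sub0r cos_geN1.
  over.
by rewrite integral_sexp_cos ltry.
Qed.

Lemma integrable_symexp : mu.-integrable setT (EFin \o sexp).
Proof.
apply: le_integrable (integrable_sexp_cos 0) => //=.
  apply/measurable_EFinP; exact: (continuous_measurable_leb continuous_sexp).
move=> t _; rewrite lee_fin !ger0_norm// mul0r cos0 ?mulr_ge0//.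
by rewrite mulrDr mulr1 lerDl.
Qed.

Let Rintegral_sexp : Rintegral mu setT sexp = 2.
Proof.
have := integral_sexp_cos 0 => /(congr1 fine) /=.
rewrite expr0n/= addr0 invr1 => e; apply: (@mulIf _ 2) => //.
rewrite -RintegralZr//; last exact: integrable_symexp.
rewrite -[RHS]e; congr fine; apply: eq_integral => t _.
by rewrite mul0r cos0.
Qed.

Lemma integral_odd (f : R -> R) : measurable_fun setT f ->
  (forall t, f (- t) = - f t) -> Rintegral mu setT f = 0.
Proof.
move=> mf fN; rewrite /Rintegral integralE.
have -> : (\int[mu]_x ((fun x => (f x)%:E)^\- x) =
           \int[mu]_x ((fun x => (f x)%:E)^\+ x))%E.
  rewrite -[RHS](@lebesgue_affine _ 0 (-1)) ?oppr_eq0 ?oner_eq0//; last first.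
    by apply/measurable_funepos/measurable_EFinP.
  rewrite normrN1 mul1e; apply: eq_integral => t _.
  pose F t : \bar R := (f t)%:E.
  rewrite add0r mulN1r -[RHS]/((F^\+ \o -%R)%E t) -funepos_comp.
  rewrite (_ : F \o -%R = (\- F)%E) ?funeposN//.
  by apply/funext => x; rewrite /F /= fN EFinN.
set I := (integral _ _ _); case: I => [r| |] //=.
by rewrite subrr.
Qed.

(** The sine part vanishes by oddness. The cosine part is the difference of two
    integrals of nonnegative functions, [integral_sexp_cos] at [y] and half of it
    at [0]. *)
Lemma cint_symexp y :
  cintegrable mu (fun t => (expR (- `|t|))%:C%C * expi (y * t)) /\
  cint mu (fun t => (expR (- `|t|))%:C%C * expi (y * t)) =
    (2 / (1 + y ^+ 2))%:C%C.
Proof.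
have ci : cintegrable mu (fun t => (expR (- `|t|))%:C%C * expi (y * t)).
  refine (dominated_cintegrable _ integrable_symexp _).
  - apply: cmeasurableM.
      apply: cmeasurable_real.
      exact: (continuous_measurable_leb continuous_sexp).
    by apply: cmeasurable_expi; exact: measurable_funM.
  - by move=> t; rewrite Normc.normcM normc_expi mulr1 normc_real
      ger0_norm ?expR_ge0.
split => //; rewrite /cint; congr (_ +i* _)%C.
- transitivity
    (Rintegral mu setT (fun t => sexp t * (1 + cos (y * t)) - sexp t)).
    by apply: eq_Rintegral => t _; rewrite Re_realM /= mulrDr mulr1 addrC addKr.
  rewrite (RintegralB measurableT (integrable_sexp_cos y) integrable_symexp).
  rewrite Rintegral_sexp {1}/Rintegral integral_sexp_cos /=.
  by rewrite mulrDr mulr1 addrC addKr.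
- apply: integral_odd; first exact: (cintegrable_measurable ci).2.
  by move=> t; rewrite !Im_realM /= normrN mulrN sinN mulrN.
Qed.

(** The primitive is the arctangent, and [c] is 2 pi. *)
Lemma cint_poisson1 : exists2 c : R, 0 < c &
  cintegrable mu (fun t => (2 / (1 + t ^+ 2))%:C%C) /\
  cint mu (fun t => (2 / (1 + t ^+ 2))%:C%C) = c%:C%C.
Proof.
pose k t : R := 2 / (1 + t ^+ 2).
have k0 t : 0 <= k t by rewrite /k divr_ge0 ?ltW.
have ck : continuous k.
  move=> t; apply: cvgM; first exact: cvg_cst.
  exact: continuous_oneDsqrV.
have Ik : (\int[mu]_t (k t)%:E = (2 * pi)%:E)%E.
  rewrite ge0_symfun_integralT//; last by move=> t; rewrite /k/= sqrrN.
  rewrite -set_itvcy /k.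
  under eq_integral do rewrite EFinM.
  rewrite ge0_integralZl//=.
  - rewrite integral0y_oneDsqr -EFinM; congr EFin.
    by rewrite [2 * (pi / 2)]mulrC divfK.
  - apply/measurable_EFinP/measurable_funTS.
    exact: (continuous_measurable_leb continuous_oneDsqrV).
  - by move=> t _; rewrite lee_fin invr_ge0 ltW.
exists (2 * pi); first by rewrite mulr_gt0 ?pi_gt0.
split; last by rewrite /cint /= /Rintegral Ik/= integral0.
split => /=; last exact: integrable0.
apply/integrableP; split.
  by apply/measurable_EFinP; exact: (continuous_measurable_leb ck).
under eq_integral do rewrite /= ger0_norm ?k0//.
by rewrite Ik ltry.
Qed.

End one_dimensional_kernel.

(** * Dominated convergence, change of variables and the Euclidean norm *)
Lemma cint_dominated_cvg d (T : measurableType d) (R : realType)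
    (mu : {measure set T -> \bar R}) (f_ : nat -> T -> R[i]) (f : T -> R[i])
    (g : T -> R) :
  (forall n, cmeasurable (f_ n)) -> cmeasurable f ->
  (forall x, Re (f_ n x) @[n --> \oo] --> Re (f x)) ->
  (forall x, Im (f_ n x) @[n --> \oo] --> Im (f x)) ->
  mu.-integrable setT (EFin \o g) -> (forall n x, normc (f_ n x) <= g x) ->
  Re (cint mu (f_ n)) @[n --> \oo] --> Re (cint mu f) /\
  Im (cint mu (f_ n)) @[n --> \oo] --> Im (cint mu f).
Proof.
move=> mf_ mf cR cI ig fg.
have key (P : R[i] -> R) : (forall z, `|P z| <= normc z) ->
    (forall n, measurable_fun setT (fun x => P (f_ n x))) ->
    measurable_fun setT (fun x => P (f x)) ->
    (forall x, P (f_ n x) @[n --> \oo] --> P (f x)) ->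
    Rintegral mu setT (fun x => P (f_ n x)) @[n --> \oo] -->
    Rintegral mu setT (fun x => P (f x)).
  move=> Pn mPn mP cP; rewrite /Rintegral.
  have [] := @dominated_convergence _ _ _ mu setT measurableT
    (fun n x => (P (f_ n x))%:E) (fun x => (P (f x))%:E) (EFin \o g).
  - by move=> n; exact/measurable_EFinP.
  - exact/measurable_EFinP.
  - by apply: aeW => x _; apply: cvg_EFin; [exact: nearW|exact: cP].
  - exact: ig.
  - by apply: aeW => x n _ /=; rewrite lee_fin (le_trans (Pn _)).
  move=> iP _ cvgP; apply: fine_cvg.
  by rewrite fineK//; exact: integrable_fin_num.
split.
- exact: (key (@complex.Re R) (@normr_Re_le R) (fun n => (mf_ n).1) mf.1 cR).
- exact: (key (@complex.Im R) (@normr_Im_le R) (fun n => (mf_ n).2) mf.2 cI).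
Qed.

Section rV_change_of_variables.
Context {R : realType} (n : nat).
Local Notation Rn := 'rV[R]_n.
Local Notation lam := (@lebesgue_rV R n).

Lemma integrable_affine (a : Rn) (s : R) (g : Rn -> R) : s != 0 ->
  lam.-integrable setT (EFin \o g) ->
  lam.-integrable setT (EFin \o (fun x => g (a + s *: x))) /\
  `|s| ^+ n * Rintegral lam setT (fun x => g (a + s *: x)) =
  Rintegral lam setT g.
Proof.
move=> s0 ig; have /integrableP[mg goo] := ig.
have ig' : lam.-integrable setT (EFin \o (fun x => g (a + s *: x))).
  apply/integrableP; split.
    exact: (measurableT_comp mg (measurable_affine_rV a s)).
  have e := lebesgue_rV_affine a s0
    (measurableT_comp (@abse_measurable R setT) mg) (fun=> abse_ge0 _).
  rewrite ltey; apply/eqP => Joo; move: goo; rewrite -[X in (X < _)%E]e Joo.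
  by rewrite gt0_muley ?ltxx// lte_fin exprn_gt0// normr_gt0.
split => //; rewrite /Rintegral.
rewrite -[X in X * _]/(fine (`|s| ^+ n)%:E) -fineM//; last first.
  exact: (integrable_fin_num measurableT ig').
congr fine; rewrite [in LHS]integralE [in RHS]integralE muleBr//; last first.
  exact: (integrable_add_def measurableT ig').
congr (_ - _)%E.
- rewrite -(lebesgue_rV_affine a s0 (measurable_funepos mg) (funepos_ge0 _)).
  congr (_ * _)%E; apply: eq_integral => x _.
  rewrite -[RHS]/(((EFin \o g)^\+ \o (fun x => (a + s *: x)%R))%E x).
  by rewrite -funepos_comp.
- rewrite -(lebesgue_rV_affine a s0 (measurable_funeneg mg) (funeneg_ge0 _)).
  congr (_ * _)%E; apply: eq_integral => x _.
  rewrite -[RHS]/(((EFin \o g)^\- \o (fun x => (a + s *: x)%R))%E x).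
  by rewrite -funeneg_comp.
Qed.

Lemma cint_affine (a : Rn) (s : R) (g : Rn -> R[i]) : s != 0 ->
  cintegrable lam g ->
  cintegrable lam (fun x => g (a + s *: x)) /\
  (`|s| ^+ n)%:C%C * cint lam (fun x => g (a + s *: x)) = cint lam g.
Proof.
move=> s0 [/(integrable_affine a s0)[iR eR] /(integrable_affine a s0)[iI eI]].
split; first by split.
by apply/eqP; rewrite eq_complex Re_realM Im_realM /= eR eI !eqxx.
Qed.

End rV_change_of_variables.

Section euclidean_norm.
Context {R : realType} (n : nat).
Implicit Types x y : 'rV[R]_n.

Lemma dotC x y : dot x y = dot y x.
Proof. by apply: eq_bigr => i _; rewrite mulrC. Qed.

Lemma dotDl x y z : dot (x + y) z = dot x z + dot y z.
Proof. by rewrite -big_split; apply: eq_bigr => i _; rewrite mxE mulrDl. Qed.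

Lemma dotZl (a : R) x y : dot (a *: x) y = a * dot x y.
Proof. by rewrite mulr_sumr; apply: eq_bigr => i _; rewrite mxE mulrA. Qed.

Lemma dotDr x y z : dot x (y + z) = dot x y + dot x z.
Proof. by rewrite dotC dotDl ![dot _ x]dotC. Qed.

Lemma dotZr (a : R) x y : dot x (a *: y) = a * dot x y.
Proof. by rewrite dotC dotZl dotC. Qed.

Lemma dot_ge0 x : 0 <= dot x x.
Proof. by apply: sumr_ge0 => i _; rewrite -expr2 sqr_ge0. Qed.

Lemma dot_eq0 x y : dot y y = 0 -> dot x y = 0.
Proof.
move=> /eqP; rewrite psumr_eq0 => [|i _]; last by rewrite -expr2 sqr_ge0.
move=> /allP y0; apply: big1 => i _.
have /y0 : i \in index_enum 'I_n by rewrite mem_index_enum.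
by rewrite mulf_eq0 orbb => /eqP ->; rewrite mulr0.
Qed.

(** Expand the square of [dot y y *: x - dot x y *: y]. *)
Lemma Cauchy_Schwarz_dot x y : dot x y ^+ 2 <= dot x x * dot y y.
Proof.
have [/dot_eq0 ->|yy0] := eqVneq (dot y y) 0.
  by rewrite expr0n mulr_ge0// dot_ge0.
have yy : 0 < dot y y by rewrite lt_neqAle eq_sym yy0 dot_ge0.
have := dot_ge0 (dot y y *: x - dot x y *: y).
rewrite -scaleNr !dotDl !dotDr !dotZl !dotZr (dotC y x) => h.
rewrite -subr_ge0 -(pmulr_rge0 _ yy).
by apply: le_trans h _; rewrite le_eqVlt; apply/orP; left; apply/eqP; ring.
Qed.

Lemma enorm_ge0 x : 0 <= enorm x. Proof. exact: sqrtr_ge0. Qed.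

Lemma ler_enormD x y : enorm (x + y) <= enorm x + enorm y.
Proof.
rewrite -(@ler_pXn2r _ 2) ?nnegrE ?addr_ge0 ?enorm_ge0// sqrrD.
rewrite !sqr_sqrtr ?dot_ge0// dotDl !dotDr (dotC y x) -addrA
  [leRHS]addrAC -addrA lerD2l.
rewrite addrA [leRHS]addrC lerD2r -mulr2n lerMn2r orFb.
rewrite /enorm -sqrtrM ?dot_ge0// (le_trans (ler_norm _))// -sqrtr_sqr.
exact/ler_wsqrtr/Cauchy_Schwarz_dot.
Qed.

Lemma measurable_enorm : measurable_fun setT (@enorm R n).
Proof.
apply: (measurableT_comp (continuous_measurable_fun (@sqrt_continuous R))).
exact: measurable_dot.
Qed.

End euclidean_norm.

(** * The Abel kernel and compactly supported functions *)
Section parametric_measurability.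
Context d1 d2 (T1 : measurableType d1) (T2 : measurableType d2) (R : realType).
Variable m2 : {sigma_finite_measure set T2 -> \bar R}.

(** The positive and the negative parts are handled by Tonelli, and the difference
    of their integrals is measurable whatever values they take. *)
Lemma measurable_Rintegral (F : T1 * T2 -> R) : measurable_fun setT F ->
  measurable_fun setT (fun x => Rintegral m2 setT (fun y => F (x, y))).
Proof.
move=> mF.
suff mI : measurable_fun setT (fun x => \int[m2]_y (F (x, y))%:E)%E.
  exact: (measurableT_comp _ mI).
pose E : T1 * T2 -> \bar R := EFin \o F.
have mE : measurable_fun setT E by exact/measurable_EFinP.
rewrite (_ : (fun x => _) =
    (fun x => fubini_F m2 E^\+ x - fubini_F m2 E^\- x)%E); last first.
  apply/funext => x; rewrite integralE; congr (_ - _)%E.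
  - apply: eq_integral => y _.
    by rewrite -[RHS]/((E^\+ \o pair x)%E y) -funepos_comp.
  - apply: eq_integral => y _.
    by rewrite -[RHS]/((E^\- \o pair x)%E y) -funeneg_comp.
apply: emeasurable_funB.
- apply: measurable_fun_fubini_tonelli_F; last exact: funepos_ge0.
  exact: measurable_funepos.
- apply: measurable_fun_fubini_tonelli_F; last exact: funeneg_ge0.
  exact: measurable_funeneg.
Qed.

Lemma cmeasurable_cint (F : T1 * T2 -> R[i]) : cmeasurable F ->
  cmeasurable (fun x => cint m2 (fun y => F (x, y))).
Proof.
by move=> [mR mI]; split;
  [exact: measurable_Rintegral mR|exact: measurable_Rintegral mI].
Qed.

End parametric_measurability.

Section kernels.
Context {R : realType} {d : nat}.
Local Notation Rd := 'rV[R]_d.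
Local Notation lam := (@lebesgue_rV R d).

Lemma expi_sum (I : Type) (s : seq I) (a : I -> R) :
  \prod_(i <- s) expi (a i) = expi (\sum_(i <- s) a i).
Proof. by rewrite (big_morph expi (@expiD R) (@expi0 R)). Qed.

Definition l1 (x : Rd) : R := \sum_i `|x ord0 i|.
(** The integrable factor [abel (s *: _)] makes Fourier integrals absolutely
    convergent and tends to 1 as [s] tends to 0; its Fourier transform is the
    dilation by [s] of the approximate identity [poisson]. *)
Definition abel (x : Rd) : R := expR (- l1 x).
Definition poisson (y : Rd) : R := \prod_i (2 / (1 + y ord0 i ^+ 2)).

Lemma l1Z (s : R) x : l1 (s *: x) = `|s| * l1 x.
Proof. by rewrite /l1 mulr_sumr; apply: eq_bigr => i _; rewrite mxE normrM. Qed.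

Lemma l1_ge0 x : 0 <= l1 x. Proof. by apply: sumr_ge0. Qed.

Lemma abel_le1 x : abel x <= 1.
Proof. by rewrite /abel -expR0 ler_expR oppr_le0 l1_ge0. Qed.

Lemma poisson_ge0 y : 0 <= poisson y.
Proof. by apply: prodr_ge0 => i _; rewrite divr_ge0// addr_ge0// sqr_ge0. Qed.

Lemma poisson_le y : poisson y <= 2 ^+ d.
Proof.
rewrite /poisson -[in leRHS](card_ord d) -prodr_const; apply: ler_prod => i _.
have h : 1 <= 1 + y ord0 i ^+ 2 by rewrite lerDl sqr_ge0.
rewrite divr_ge0 ?(le_trans _ h)//= ler_pdivrMr ?(lt_le_trans _ h)//.
by rewrite ler_peMr.
Qed.

Lemma cintegrable_abel (y : Rd) :
  cintegrable lam (fun x => (abel x)%:C%C * expi (dot x y)) /\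
  cint lam (fun x => (abel x)%:C%C * expi (dot x y)) = (poisson y)%:C%C.
Proof.
have [ci ce] := cint_tensor (fun i : 'I_d => (cint_symexp (y ord0 i)).1).
have E (x : Rd) :
    \prod_i ((expR (- `|x ord0 i|))%:C%C * expi (y ord0 i * x ord0 i)) =
    (abel x)%:C%C * expi (dot x y).
  rewrite big_split/= expi_sum -rmorph_prod; congr (_ * _).
    by rewrite /abel /l1 -sumrN expR_sum.
  by congr expi; apply: eq_bigr => i _; rewrite mulrC.
rewrite (funext E) in ci; rewrite (funext E) in ce.
split => //; rewrite ce /poisson rmorph_prod; apply: eq_bigr => i _.
exact: (cint_symexp _).2.
Qed.

Lemma integrable_abel : lam.-integrable setT (EFin \o abel).
Proof.
have := integrable_normc (cintegrable_abel 0).1; apply: eq_integrable => // x _.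
by rewrite Normc.normcM normc_expi mulr1 normc_real ger0_norm ?expR_ge0.
Qed.

Lemma measurable_abel : measurable_fun setT abel.
Proof.
by apply/measurable_EFinP; exact: (measurable_int _ integrable_abel).
Qed.

Lemma cintegrable_abel_scaled (s : R) (z : Rd) : s != 0 ->
  cintegrable lam (fun x => (abel (s *: x))%:C%C * expi (dot x z)) /\
  (`|s| ^+ d)%:C%C * cint lam (fun x => (abel (s *: x))%:C%C * expi (dot x z)) =
  (poisson (s^-1 *: z))%:C%C.
Proof.
move=> s0; have [ci <-] := cintegrable_abel (s^-1 *: z).
have := cint_affine 0 s0 ci.
under eq_fun do rewrite add0r dotZl dotZr mulrA mulfV// mul1r.
by [].
Qed.

Lemma cintegrable_poisson : cintegrable lam (fun x => (poisson x)%:C%C) /\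
  exists2 c : R, 0 < c & cint lam (fun x => (poisson x)%:C%C) = c%:C%C.
Proof.
have [c c0 [ci ce]] := @cint_poisson1 R.
have [ti te] := cint_tensor (fun i : 'I_d => ci).
have E (x : Rd) : \prod_i (2 / (1 + x ord0 i ^+ 2))%:C%C = (poisson x)%:C%C.
  by rewrite /poisson rmorph_prod.
rewrite (funext E) in ti; rewrite (funext E) in te.
split => //; exists (c ^+ d); first exact: exprn_gt0.
by rewrite te prodr_const card_ord ce rmorphXn.
Qed.

Lemma measurable_poisson : measurable_fun setT poisson.
Proof. exact: (cintegrable_measurable cintegrable_poisson.1).1. Qed.

End kernels.

Section compactly_supported.
Context {R : realType} {d : nat}.
Local Notation Rd := 'rV[R]_d.
Local Notation lam := (@lebesgue_rV R d).
Implicit Types f chi : Rd -> R[i].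

Lemma csupport_eq0 f x : ~ csupport f x -> f x = 0.
Proof.
by move=> fx; apply/eqP/negPn/negP => fx0; apply: fx; exact: subset_closure.
Qed.

Lemma ler_coord_norm (x : Rd) i : `|x ord0 i| <= `|x|.
Proof.
rewrite [leRHS]/Num.norm/= mx_normrE; apply/bigmax_geP; right.
by exists (ord0, i).
Qed.

(** Domination by [abel] replaces boundedness on a set of finite measure: it
    yields integrability and boundedness at once. *)
Lemma compact_csupport_bound f : ccontinuous f -> compact (csupport f) ->
  exists2 M, 0 <= M & forall x, normc (f x) <= M * abel x.
Proof.
move=> [cR cI] cf.
have bnd (h : Rd -> R) : continuous h ->
    exists2 M, 0 <= M & forall x, csupport f x -> `|h x| <= M.
  move=> ch; have : compact (h @` csupport f).
    by apply: continuous_compact => //; exact: continuous_subspaceT.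
  move=> /compact_bounded[M [_ hM]]; exists (`|M| + 1) => [|x fx].
    by rewrite addr_ge0.
  by apply: (hM (`|M| + 1)); [rewrite ltr_pwDr// ler_norm|exists x].
have [MR MR0 hR] := bnd _ cR; have [MI MI0 hI] := bnd _ cI.
have [N N0 hN] : exists2 N, 0 <= N & forall x, csupport f x -> l1 x <= N.
  have [M [_ hM]] := compact_bounded cf.
  exists (\sum_(i < d) (`|M| + 1)) => [|x fx].
    by apply: sumr_ge0 => i _; rewrite addr_ge0.
  apply: ler_sum => i _; apply: (@le_trans _ _ `|x|).
    exact: ler_coord_norm.
  by apply: (hM (`|M| + 1)) => //; rewrite ltr_pwDr// ler_norm.
exists ((MR + MI) * expR N) => [|x].
  by rewrite mulr_ge0 ?addr_ge0 ?expR_ge0.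
have [fx|fx] := pselect (csupport f x); last first.
  by rewrite csupport_eq0// Normc.normc0 !mulr_ge0 ?addr_ge0 ?expR_ge0.
rewrite -mulrA -expRD (le_trans (normc_le _))// -[leLHS]mulr1
  ler_pM ?addr_ge0//.
  by rewrite lerD ?hR ?hI.
by rewrite -expR0 ler_expR subr_ge0 hN.
Qed.

Lemma compact_cintegrable f : ccontinuous f -> compact (csupport f) ->
  cintegrable lam f.
Proof.
move=> cf Kf; have [M M0 hM] := compact_csupport_bound cf Kf.
apply: (dominated_cintegrable (ccontinuous_measurable cf) _ hM).
under [X in _.-integrable _ X]eq_fun do rewrite /= EFinM.
exact/integrableZl/integrable_abel.
Qed.

Lemma cintegrableM_compact chi f : ccontinuous chi -> compact (csupport chi) ->
  cintegrable lam f -> cintegrable lam (fun x => chi x * f x).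
Proof.
move=> cchi Kchi intf; have [M M0 hM] := compact_csupport_bound cchi Kchi.
apply: (dominated_cintegrable (g := fun x => M * normc (f x))).
- apply: cmeasurableM; first exact: ccontinuous_measurable.
  exact: cintegrable_measurable intf.
- under [X in _.-integrable _ X]eq_fun do rewrite /= EFinM.
  by apply: integrableZl => //; exact: integrable_normc.
- move=> x; rewrite Normc.normcM ler_wpM2r ?normc_ge0//.
  by rewrite (le_trans (hM x))// ler_piMr// abel_le1.
Qed.

Lemma cintegrable_char f (h : Rd -> R) :
  cintegrable lam f -> measurable_fun setT h ->
  cintegrable lam (fun x => f x * expi (h x)).
Proof.
move=> cf mh; apply: (dominated_cintegrable _ (integrable_normc cf)).
- apply: cmeasurableM; first exact: cintegrable_measurable cf.
  exact: cmeasurable_expi.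
- by move=> x; rewrite Normc.normcM normc_expi mulr1.
Qed.

Lemma cmeasurable_fourier f : cmeasurable f -> cmeasurable (fourier f).
Proof.
move=> mf.
apply: (@cmeasurable_cint _ _ _ _ R lam
  (fun p : Rd * Rd => f p.2 * expi (- dot p.2 p.1))).
apply: cmeasurableM; first exact: cmeasurable_comp mf measurable_snd.
by apply: cmeasurable_expi; apply: measurableT_comp => //;
  exact: measurable_dot.
Qed.

End compactly_supported.

(** * Fourier inversion *)
Section fourier_inversion.
Context {R : realType} {d : nat}.
Local Notation Rd := 'rV[R]_d.
Local Notation lam := (@lebesgue_rV R d).
Implicit Types f : Rd -> R[i].

(** Abel summation of the inverse Fourier integral: exchanging the integrals
    leaves the Fourier transform of [abel (s *: _)] at [x - y], a Poisson kernel
    of width [s], and the substitution of [x - s y] for [y] moves the scale into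
    [f]. *)
Lemma mollified_inversion f (x : Rd) (s : R) : 0 < s ->
  ccontinuous f -> compact (csupport f) ->
  cint lam (fun eta =>
    (abel (s *: eta))%:C%C * (fourier f eta * expi (dot eta x))) =
  cint lam (fun y => (poisson y)%:C%C * f (x + (- s) *: y)).
Proof.
move=> s0 cf Kf; have sn0 : s != 0 by rewrite gt_eqF.
have mf := ccontinuous_measurable cf.
have intf := compact_cintegrable cf Kf.
pose P (eta : Rd) : R[i] := (abel (s *: eta))%:C%C.
have intP : cintegrable lam P.
  have := (cintegrable_abel_scaled (0 : Rd) sn0).1; congr cintegrable.
  apply/funext => eta; rewrite (_ : dot eta 0 = 0) ?expi0 ?mulr1//.
  by apply: big1 => i _; rewrite mxE mulr0.
pose H (p : Rd * Rd) :=
  P p.1 * expi (dot p.1 x) * (f p.2 * expi (- dot p.2 p.1)).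
have intH : cintegrable (lam \x lam)%E H.
  apply: (dominated_cintegrable _
    (integrable_normc (cintegrable_prod intP intf))).
    apply: cmeasurableM; apply: cmeasurableM.
    - exact: cmeasurable_comp (cintegrable_measurable intP) measurable_fst.
    - by apply: cmeasurable_expi; exact: measurable_dot.
    - exact: cmeasurable_comp mf measurable_snd.
    - by apply: cmeasurable_expi; apply: measurableT_comp => //;
        exact: measurable_dot.
  by move=> p; rewrite /H !Normc.normcM !normc_expi !mulr1.
(* [K] is the Poisson kernel centred at [x], and [G] is its product with [f]. *)
pose K (y : Rd) := (s ^- d * poisson (s^-1 *: (x - y)))%:C%C.
have KE y : cint lam (fun eta => P eta * expi (dot eta (x - y))) = K y.
  have [_] := cintegrable_abel_scaled (x - y) sn0.
  rewrite (gtr0_norm s0) -/P /K rmorphM/= => <-.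
  by rewrite mulrA -rmorphM/= mulVf ?mul1r// expf_neq0.
pose G y := K y * f y.
have intG : cintegrable lam G.
  apply: (dominated_cintegrable (g := fun y => s ^- d * 2 ^+ d * normc (f y))).
  - apply: cmeasurableM => //; apply: cmeasurable_real;
      apply: measurable_funM => //.
    apply: (measurableT_comp measurable_poisson).
    rewrite (_ : (fun y => _) = (fun y => s^-1 *: x + (- s^-1) *: y)).
      exact: measurable_affine_rV.
    by apply/funext => y; rewrite scalerBr scaleNr.
  - under [X in _.-integrable _ X]eq_fun do rewrite /= EFinM.
    exact/integrableZl/integrable_normc.
  - move=> y; rewrite Normc.normcM ler_wpM2r ?normc_ge0// normc_real.
    have sd0 : 0 <= s ^- d by rewrite invr_ge0 exprn_ge0// ltW.
    rewrite ger0_norm ?ler_wpM2l ?poisson_le//.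
    exact: (mulr_ge0 sd0 (poisson_ge0 _)).
transitivity (cint lam (fun eta => cint lam (fun y => H (eta, y)))).
  apply: eq_cint => eta; rewrite /H/= cintZl -?mulrA.
    by rewrite [expi _ * _]mulrC.
  apply: (cintegrable_char intf); apply: measurableT_comp => //.
  exact: measurable_dot.
rewrite (cFubini intH); transitivity (cint lam G).
  apply: eq_cint => y; rewrite /G -KE mulrC -cintZl; last first.
    exact: (cintegrable_abel_scaled _ sn0).1.
  apply: eq_cint => eta; rewrite /H/= dotDr.
  rewrite (_ : dot eta (- y) = - dot y eta) ?expiD; first by ring.
  by rewrite -scaleN1r dotZr mulN1r dotC.
have Ns0 : - s != 0 by rewrite oppr_eq0.
have [iG <-] := cint_affine x Ns0 intG.
rewrite -cintZl//; apply: eq_cint => y; rewrite /G mulrA; congr (_ * _).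
rewrite normrN gtr0_norm// /K -rmorphM/=; congr (_%:C)%C.
rewrite mulrA mulfV ?expf_neq0// mul1r; congr poisson.
by rewrite opprD addrA subrr add0r scaleNr opprK scalerA mulVf// scale1r.
Qed.

(** Let the parameter [s] of [mollified_inversion] tend to 0. The left-hand side
    converges because the Fourier transform of [f] is integrable, the right-hand
    side because [f] is bounded and continuous. The constant [c] is
    (2 pi)^d. *)
Lemma fourier_inversion f (x : Rd) (c : R) :
  cint lam (fun y : Rd => (poisson y)%:C%C) = c%:C%C ->
  ccontinuous f -> compact (csupport f) -> cintegrable lam (fourier f) ->
  c%:C%C * f x = cint lam (fun eta => fourier f eta * expi (dot eta x)).
Proof.
move=> cE cf Kf iF; have mf := ccontinuous_measurable cf.
(* [A] and [B] are the integrands of the two sides of [mollified_inversion]. *)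
pose s n : R := n.+1%:R^-1.
have s0 n : 0 < s n by rewrite invr_gt0.
have scvg : s n @[n --> \oo] --> (0 : R) by exact: cvg_harmonic.
pose A n eta := (abel (s n *: eta))%:C%C * (fourier f eta * expi (dot eta x)).
pose B n y := (poisson y)%:C%C * f (x + (- s n) *: y).
have AB n : cint lam (A n) = cint lam (B n) by exact: mollified_inversion.
have iFe : cintegrable lam (fun eta => fourier f eta * expi (dot eta x)).
  by apply: cintegrable_char => //; exact: measurable_dot.
have pcvg eta : abel (s n *: eta) @[n --> \oo] --> (1 : R).
  have h : - l1 (s n *: eta) @[n --> \oo] --> (0 : R).
    have hl n : - l1 (s n *: eta) = - (s n * l1 eta).
      by rewrite l1Z ger0_norm ?ltW.
    rewrite (funext hl).
    rewrite -[X in _ --> X]oppr0; apply: cvgN.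
    rewrite -[X in _ --> X](mul0r (l1 eta)); apply: cvgM => //; exact: cvg_cst.
  rewrite -[X in _ --> X]expR0; apply: (cvg_comp _ _ h); exact: continuous_expR.
have [|||||n eta|AR AI] := @cint_dominated_cvg _ _ R lam A
  (fun eta => fourier f eta * expi (dot eta x))
  (fun eta => normc (fourier f eta)).
- move=> n; apply: cmeasurableM; last exact: cintegrable_measurable iFe.
  apply: cmeasurable_real; apply: (measurableT_comp measurable_abel).
  have := measurable_affine_rV (0 : Rd) (s n).
  by rewrite (funext (fun eta => add0r (s n *: eta))).
- exact: cintegrable_measurable iFe.
- move=> eta; rewrite (funext (fun n => Re_realM (abel (s n *: eta)) _)).
  by rewrite -[X in _ --> X]mul1r; apply: cvgM => //; exact: cvg_cst.
- move=> eta; rewrite (funext (fun n => Im_realM (abel (s n *: eta)) _)).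
  by rewrite -[X in _ --> X]mul1r; apply: cvgM => //; exact: cvg_cst.
- exact: integrable_normc.
- rewrite /A !Normc.normcM normc_expi mulr1 normc_real ger0_norm ?expR_ge0//.
  by rewrite ler_piMl ?normc_ge0// abel_le1.
have [M M0 hM] := compact_csupport_bound cf Kf.
have xcvg y : x + (- s n) *: y @[n --> \oo] --> x.
  rewrite -[X in _ --> X]addr0; apply: cvgD; first exact: cvg_cst.
  rewrite -[X in _ --> X](scale0r y); apply: cvgZ; last exact: cvg_cst.
  by rewrite -oppr0; exact: cvgN.
have [|||||n y|BR BI] := @cint_dominated_cvg _ _ R lam B
  (fun y => (poisson y)%:C%C * f x) (fun y => M * poisson y).
- move=> n; apply: cmeasurableM.
    exact: cmeasurable_real measurable_poisson.
  exact: cmeasurable_comp mf (measurable_affine_rV x (- s n)).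
- apply: cmeasurableM; first exact: cmeasurable_real measurable_poisson.
  exact: cmeasurable_cst.
- move=> y.
  rewrite (funext (fun n => Re_realM (poisson y) (f (x + - s n *: y)))).
  rewrite Re_realM; apply: cvgM; first exact: cvg_cst.
  apply: (cvg_comp _ (fun z => Re (f z)) (xcvg y)); exact: cf.1.
- move=> y.
  rewrite (funext (fun n => Im_realM (poisson y) (f (x + - s n *: y)))).
  rewrite Im_realM; apply: cvgM; first exact: cvg_cst.
  apply: (cvg_comp _ (fun z => Im (f z)) (xcvg y)); exact: cf.2.
- under [X in _.-integrable _ X]eq_fun do rewrite /= EFinM.
  apply: integrableZl => //; exact: cintegrable_poisson.1.1.
- rewrite /B Normc.normcM normc_real ger0_norm ?poisson_ge0// mulrC.
  rewrite ler_wpM2r ?poisson_ge0//.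
  by rewrite (le_trans (hM _))// ler_piMr// abel_le1.
have lim : cint lam (fun y => (poisson y)%:C%C * f x) =
    cint lam (fun eta => fourier f eta * expi (dot eta x)).
  apply/eqP; rewrite eq_complex; apply/andP; split; apply/eqP.
  - move: AR; rewrite (funext (fun n => congr1 (@complex.Re R) (AB n))) => AR.
    exact: cvg_unique BR AR.
  - move: AI; rewrite (funext (fun n => congr1 (@complex.Im R) (AB n))) => AI.
    exact: cvg_unique BI AI.
rewrite -lim; under [in RHS]eq_cint do rewrite mulrC.
by rewrite cintZl ?cE 1?mulrC//; exact: cintegrable_poisson.1.
Qed.

End fourier_inversion.

(** * Submultiplicativity of the weighted norms *)
Section submultiplicativity.
Context {R : realType} {d : nat}.
Local Notation Rd := 'rV[R]_d.
Local Notation lam := (@lebesgue_rV R d).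
Implicit Types f chi : Rd -> R[i].

(** The Fourier transform of a product is a convolution: insert the inversion
    formula for [chi] and exchange the integrals. *)
Lemma fourierM chi f (xi : Rd) (c : R) :
  cint lam (fun y : Rd => (poisson y)%:C%C) = c%:C%C ->
  ccontinuous chi -> compact (csupport chi) -> cintegrable lam (fourier chi) ->
  ccontinuous f -> compact (csupport f) ->
  c%:C%C * fourier (fun x => chi x * f x) xi =
  cint lam (fun eta => fourier chi eta * fourier f (xi - eta)).
Proof.
move=> cE cchi Kchi iF cf Kf; have intf := compact_cintegrable cf Kf.
have icf := cintegrableM_compact cchi Kchi intf.
have mch (h : Rd) : measurable_fun setT (fun x : Rd => - dot x h).
  by apply: measurableT_comp => //; exact: measurable_dot.
pose H (p : Rd * Rd) :=
  fourier chi p.2 * expi (dot p.2 p.1) * (f p.1 * expi (- dot p.1 xi)).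
have intH : cintegrable (lam \x lam)%E H.
  apply: (dominated_cintegrable _
    (integrable_normc (cintegrable_prod intf iF))).
    apply: cmeasurableM; apply: cmeasurableM.
    - exact: cmeasurable_comp (cintegrable_measurable iF) measurable_snd.
    - by apply: cmeasurable_expi; exact: measurable_dot.
    - exact: cmeasurable_comp (cintegrable_measurable intf) measurable_fst.
    - by apply: cmeasurable_expi; apply: measurableT_comp => //;
        exact: measurable_dot.
  by move=> p; rewrite /H !Normc.normcM !normc_expi !mulr1 mulrC.
transitivity (cint lam (fun x => cint lam (fun eta => H (x, eta)))).
  rewrite -cintZl; last exact: cintegrable_char icf (mch xi).
  apply: eq_cint => x; rewrite mulrA mulrA (fourier_inversion x cE)// -mulrA
    mulrC -cintZl.
    by apply: eq_cint => eta; rewrite /H/= mulrC.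
  by apply: cintegrable_char => //; exact: measurable_dot.
rewrite (cFubini intH); apply: eq_cint => eta.
rewrite -cintZl; last exact: cintegrable_char intf (mch _).
apply: eq_cint => x; rewrite /H/= dotDr.
rewrite (_ : dot x (- eta) = - dot eta x).
  by rewrite opprD opprK expiD; ring.
by rewrite -scaleN1r dotZr mulN1r dotC.
Qed.

Lemma fourier_bounded f : cintegrable lam f ->
  exists b, forall xi, normc (fourier f xi) <= b.
Proof.
move=> intf; exists (Rintegral lam setT (fun x => normc (f x))) => xi.
have mch : measurable_fun setT (fun x : Rd => - dot x xi).
  by apply: measurableT_comp => //; exact: measurable_dot.
have := le_normc_cint (cintegrable_char intf mch).
under eq_integral do rewrite Normc.normcM normc_expi mulr1.
rewrite -[X in (_ <= X)%E]fineK ?lee_fin//.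
exact: (integrable_fin_num measurableT (integrable_normc intf)).
Qed.

Section weighted.
Variables (sigma : R -> R) (l : R).
Hypotheses (wsigma : weight sigma) (l_ge0 : 0 <= l).

Let W (xi : Rd) : R := expR (l * sigma (enorm xi)).

Let measurable_W : measurable_fun setT W.
Proof.
apply: measurableT_comp => //; apply: measurable_funM => //.
by apply: measurable_weight_comp => //;
  [exact: enorm_ge0|exact: measurable_enorm].
Qed.

Lemma measurable_wnorm_integrand f : cmeasurable f ->
  measurable_fun setT (fun xi => (normc (fourier f xi) * W xi)%:E).
Proof.
move=> mf; apply/measurable_EFinP; apply: measurable_funM => //.
exact/measurable_normc/cmeasurable_fourier.
Qed.

Let W_ge0 xi : 0 <= W xi. Proof. exact: expR_ge0. Qed.

(** Subadditivity of [sigma] makes the exponential weight submultiplicative. *)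
Let WD eta xi : W xi <= W eta * W (xi - eta).
Proof.
rewrite /W -expRD ler_expR -mulrDr ler_wpM2l//.
have [[_ sigma_nd _ _] [sigmaD _ _]] := wsigma.
apply: le_trans (sigmaD _ _ _ _); rewrite ?enorm_ge0//.
apply: sigma_nd; first exact: enorm_ge0.
by rewrite (le_trans _ (ler_enormD _ _))// addrC subrK.
Qed.

Lemma wnorm_fourier_integrable f : cmeasurable f -> (wnorm sigma l f < +oo)%E ->
  cintegrable lam (fourier f).
Proof.
move=> mf foo; apply/cintegrableP; first exact: cmeasurable_fourier.
apply: le_lt_trans foo; apply: ge0_le_integral => //.
- by move=> x _; rewrite lee_fin normc_ge0.
- exact/measurable_EFinP/measurable_normc/cmeasurable_fourier.
- exact: measurable_wnorm_integrand.
- move=> x _; rewrite lee_fin ler_peMr ?normc_ge0// -expR0 ler_expR.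
  by rewrite mulr_ge0// weight_ge0// enorm_ge0.
Qed.

(** Young's inequality for the convolution of [fourierM] in the weighted L^1
    spaces: split the weight by [WD], exchange the integrals by Tonelli and
    translate. *)
Lemma wnormM chi f (c : R) : 0 < c ->
  cint lam (fun y : Rd => (poisson y)%:C%C) = c%:C%C ->
  ccontinuous chi -> compact (csupport chi) -> (wnorm sigma l chi < +oo)%E ->
  ccontinuous f -> compact (csupport f) ->
  (c%:E * wnorm sigma l (fun x => (chi x * f x)%R) <=
   wnorm sigma l chi * wnorm sigma l f)%E.
Proof.
move=> c0 cE cchi Kchi nchi cf Kf.
have icf := cintegrableM_compact cchi Kchi (compact_cintegrable cf Kf).
have mchi := ccontinuous_measurable cchi; have mf := ccontinuous_measurable cf.
have iF := wnorm_fourier_integrable mchi nchi.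
have mFf := cmeasurable_fourier mf; have mFc := cmeasurable_fourier mchi.
have mB : measurable_fun setT (fun p : Rd * Rd => p.1 - p.2).
  apply: measurable_fun_rV => i; under eq_fun do rewrite !mxE.
  by apply: measurable_funB; apply: (measurableT_comp (measurable_coord i)).
pose T (p : Rd * Rd) : \bar R := (normc (fourier chi p.2) * W p.2 *
  (normc (fourier f (p.1 - p.2)) * W (p.1 - p.2)))%:E.
have mT : measurable_fun setT T.
  apply/measurable_EFinP; apply: measurable_funM; apply: measurable_funM.
  - exact: measurableT_comp (measurable_normc mFc) measurable_snd.
  - exact: measurableT_comp measurable_W measurable_snd.
  - exact: measurableT_comp (measurable_normc mFf) mB.
  - exact: measurableT_comp measurable_W mB.
have T0 p : (0 <= T p)%E.
  by rewrite lee_fin; apply: mulr_ge0; rewrite mulr_ge0 ?normc_ge0.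
have mchif := measurable_wnorm_integrand (cintegrable_measurable icf).
rewrite /wnorm -ge0_integralZl//; last 2 first.
- by move=> x _; rewrite lee_fin mulr_ge0 ?normc_ge0.
- by rewrite lee_fin ltW.
apply: (@le_trans _ _ (\int[lam]_xi \int[lam]_eta T (xi, eta))%E).
  apply: ge0_le_integral => //.
  - by move=> x _; rewrite mule_ge0 ?lee_fin ?mulr_ge0 ?normc_ge0// ltW.
  - by apply: measurable_funeM.
  - exact: measurable_fun_fubini_tonelli_F mT T0.
  - move=> xi _; set h := fun eta => fourier chi eta * fourier f (xi - eta).
    have mh : cmeasurable h.
      apply: (cmeasurableM mFc).
      exact: (cmeasurable_comp mFf (measurableT_comp mB (pair1_measurable xi))).
    have ih : cintegrable lam h.
      have [b hb] := fourier_bounded (compact_cintegrable cf Kf).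
      apply: (dominated_cintegrable
        (g := fun eta => b * normc (fourier chi eta)) mh).
        under [X in _.-integrable _ X]eq_fun do rewrite /= EFinM.
        by apply: integrableZl => //; exact: integrable_normc iF.
      by move=> eta; rewrite Normc.normcM mulrC ler_wpM2r ?normc_ge0.
    have -> : (c%:E *
        (normc (fourier (fun x => (chi x * f x)%R) xi) * W xi)%:E =
        (W xi)%:E * (normc (cint lam h))%:E)%E.
      rewrite -(fourierM xi cE)// Normc.normcM normc_real gtr0_norm// -!EFinM.
      by congr EFin; ring.
    apply: (@le_trans _ _ ((W xi)%:E * \int[lam]_eta (normc (h eta))%:E)%E).
      by apply: lee_wpmul2l; [rewrite lee_fin|exact: le_normc_cint].
    have mnh : measurable_fun setT (fun eta => (normc (h eta))%:E).
      by apply/measurable_EFinP; exact: measurable_normc mh.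
    rewrite -ge0_integralZl//; last 2 first.
    + by move=> eta _; rewrite lee_fin normc_ge0.
    + by rewrite lee_fin.
    apply: ge0_le_integral => //.
    + by move=> eta _; rewrite mule_ge0 ?lee_fin ?normc_ge0.
    + exact: measurable_funeM mnh.
    + exact: (measurableT_comp mT (pair1_measurable xi)).
    + move=> eta _; rewrite -EFinM lee_fin /h Normc.normcM mulrC mulrACA.
      by rewrite ler_wpM2l ?mulr_ge0 ?normc_ge0.
rewrite fubini_tonelli//.
under eq_integral => eta _.
  under eq_integral => xi _ do rewrite /T /= EFinM.
  rewrite ge0_integralZl//; last 3 first.
  - apply/measurable_EFinP; apply: measurable_funM.
    + exact: measurableT_comp (measurable_normc mFf)
        (measurableT_comp mB (pair2_measurable eta)).
    + exact: measurableT_comp measurable_W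
        (measurableT_comp mB (pair2_measurable eta)).
  - by move=> xi _; rewrite lee_fin mulr_ge0 ?normc_ge0.
  - by rewrite lee_fin mulr_ge0 ?normc_ge0.
  have e1 : (1 : R) != 0 by rewrite oner_eq0.
  have := lebesgue_rV_affine (- eta) e1 (measurable_wnorm_integrand mf)
    (fun x => eq_ind_r is_true (mulr_ge0 (normc_ge0 _) (W_ge0 x))
      (lee_fin _ _)).
  rewrite normr1 expr1n mul1e => e2.
  under eq_integral => xi _ do
    rewrite -[xi - eta]addrC -[xi in - eta + xi]scale1r.
  rewrite e2.
  over.
rewrite ge0_integralZr//.
- exact: measurable_wnorm_integrand.
- by move=> x _; rewrite lee_fin mulr_ge0 ?normc_ge0.
- by apply: integral_ge0 => x _; rewrite lee_fin mulr_ge0 ?normc_ge0.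
Qed.

End weighted.
End submultiplicativity.

(** * Uniform bounds in a fixed weight *)
Section near_zero_infinity.
Context {R : realType}.
Implicit Types (P : R -> Prop) (w : R -> R).

Lemma near0P P : (\forall e \near 0^'+, P e) <->
  exists2 d : R, 0 < d & forall e, 0 < e -> e < d -> P e.
Proof.
split=> [/nbhs_ballP[d /= d0 hd]|[d d0 hd]].
  exists d => // e e0 ed; apply: hd => //=.
  by rewrite /ball/= sub0r normrN gtr0_norm.
near=> e; apply: hd; near: e; [exact: nbhs_right_gt|exact: nbhs_right_lt].
Unshelve. all: by end_near. Qed.

Lemma near_pinfty_invP P : (\forall t \near +oo, P t) ->
  \forall e \near 0^'+, P e^-1.
Proof.
move=> [M [_ hM]]; apply/near0P; exists (`|M| + 1)^-1 => [|e e0 eM].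
  by rewrite invr_gt0 ltr_pwDr.
apply: hM; rewrite (le_lt_trans (ler_norm _))//.
rewrite (lt_trans _ (_ : `|M| + 1 < _)) ?ltrDl//.
by rewrite -[ltLHS]invrK ltf_pV2 ?posrE ?invr_gt0 ?ltr_pwDr.
Qed.

Lemma near0_invP P : (\forall e \near 0^'+, P e) -> \forall t \near +oo, P t^-1.
Proof.
move=> /near0P[d d0 hd]; near=> t.
have t0 : d^-1 < t by near: t; apply: nbhs_pinfty_gt; exact: num_real.
have tp : 0 < t by rewrite (lt_trans _ t0)// invr_gt0.
by apply: hd; rewrite ?invr_gt0// invf_plt ?posrE.
Unshelve. all: by end_near. Qed.

(** On the bounded range where [w2 <= h * w] may fail, monotonicity bounds [w2]
    by a constant. *)
Lemma weight_ll_bound w w2 h :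
  weight w -> weight w2 -> weight_ll w2 w -> 0 < h ->
  exists C, forall t, 0 <= t -> w2 t <= h * w t + C.
Proof.
move=> ww ww2 w2w h0; have [M [_ hM]] := w2w h h0.
pose T := `|M| + 1; have T0 : 0 <= T by rewrite addr_ge0.
exists (w2 T) => t t0; have [tT|Tt] := leP t T.
  rewrite -[leLHS]add0r lerD ?mulr_ge0 ?(ltW h0) ?weight_ge0//.
  by case: ww2 => -[_ nd _ _] _; exact: nd.
have := hM t; rewrite !ger0_norm ?weight_ge0// => le.
rewrite -[leLHS]addr0 lerD ?(weight_ge0 ww2)//; apply: le.
by rewrite (lt_trans _ Tt)// /T (le_lt_trans (ler_norm _))// ltrDl.
Qed.

End near_zero_infinity.

(** For a family [m e] of nonnegative densities and a radius [r] (below, Fourier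
    transforms and the Euclidean norm), bounds with every weight [w2 << w] imply
    a bound with [h * w] for some fixed [h]. *)
Section gliding_hump.
Context d (T : measurableType d) (R : realType).
Variables (mu : {measure set T -> \bar R}) (r : T -> R) (m : R -> T -> R).
Variable w : R -> R.
Hypotheses (ww : weight w) (r0 : forall x, 0 <= r x).
Hypothesis mr : measurable_fun setT r.
Hypotheses (m0 : forall e x, 0 <= m e x)
  (mm : forall e, 0 < e -> e < 1 -> measurable_fun setT (m e)).

Let I (v : R -> R) e A := (\int[mu]_(x in A) (m e x * expR (v (r x)))%:E)%E.

Let Iw h := I (fun t => h * w t).

Let measurable_integrand v e : (measurable_fun setT (fun x => v (r x))) ->
  0 < e -> e < 1 -> measurable_fun setT (fun x => (m e x * expR (v (r x)))%:E).
Proof.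
move=> mv e0 e1; apply/measurable_EFinP; apply: measurable_funM;
  first exact: mm.
exact: measurableT_comp.
Qed.

Let integrand_ge0 v e x : (0 <= (m e x * expR (v (r x)))%:E)%E.
Proof. by rewrite lee_fin mulr_ge0// expR_ge0. Qed.

Let annulus a b : set T := [set x | a <= r x /\ r x < b].

Let mball b : measurable [set x | r x < b].
Proof.
rewrite (_ : [set x | _] = r @^-1` `]-oo, b[%classic).
  by rewrite -[X in measurable X]setTI; exact: mr.
by apply/seteqP; split => x /=; rewrite in_itv.
Qed.

Let mannulus a b : measurable (annulus a b).
Proof.
rewrite (_ : annulus a b = r @^-1` `[a, b[%classic).
  by rewrite -[X in measurable X]setTI; exact: mr.
by apply/seteqP; split => x /=; rewrite in_itv/= => /andP.
Qed.

(** The mass carried by the ball of radius [a] is at most [C0 * expR (h * w a)]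
    by the unweighted bound [C0]; anything in excess of that sits outside, and
    most of it in a bounded annulus. *)
Let escaping_mass (C0 h a n e : R) :
  0 < e -> e < 1 -> 0 <= h -> 0 <= a -> 0 <= n ->
  (\int[mu]_x (m e x)%:E <= C0%:E)%E ->
  ((C0 * expR (h * w a) + n)%:E < Iw h e setT)%E ->
  exists2 b, a + 1 <= b & (n%:E <= Iw h e (annulus a b))%E.
Proof.
move=> e0 e1 h0 a0 n0 hC big; set B := (X in (X%:E < _)%E) in big.
have mw : measurable_fun setT (fun x => h * w (r x)).
  by apply: measurable_funM => //; exact: measurable_weight_comp.
have mf := @measurable_integrand (fun t => h * w t) e mw e0 e1.
have f0 x : (0 <= (m e x * expR (h * w (r x)))%:E)%E.
  exact: (integrand_ge0 (fun t => h * w t)).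
pose S (k : nat) : set T := [set x | r x < k%:R].
have [k hk] : exists k, (B%:E < Iw h e (S k))%E.
  apply/not_existsP => hle.
  have : (Iw h e (\bigcup_k S k) <= B%:E)%E.
    have cv : Iw h e (S k) @[k --> \oo] --> Iw h e (\bigcup_k S k).
      apply: ge0_nondecreasing_set_cvg_integral => //.
      - move=> i j ij; apply/subsetPset => x /= /lt_le_trans; apply.
        by rewrite ler_nat.
      - by move=> i; exact: mball.
      - by move=> i; exact: (measurable_funTS mf).
    have <- : limn (fun k => Iw h e (S k)) = Iw h e (\bigcup_k S k).
      exact: cvg_lim cv.
    apply: lime_le; first by apply/cvg_ex; eexists; exact: cv.
    by apply: nearW => k; rewrite leNgt; apply/negP; exact: hle.
  rewrite (_ : \bigcup_k S k = setT) ?leNgt ?big//.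
  apply/seteqP; split => // x _; exists (Num.truncn (r x)).+1 => //=.
  exact: truncnS_gt.
exists (Num.max (a + 1) k%:R); first by rewrite le_max lexx.
set b := Num.max _ _; rewrite leNgt; apply/negP => lt.
have : (Iw h e (S k) <= B%:E)%E; last by rewrite leNgt hk.
apply: (@le_trans _ _ (Iw h e ([set x | r x < a] `|` annulus a b))).
  apply: ge0_subset_integral; [exact: mball|by apply: measurableU|
    exact: (measurable_funTS mf)|by move=> x _; exact: f0|].
  move=> x /= xk; have [ra|ra] := ltP (r x) a; [by left|right; split => //].
  by rewrite lt_max xk orbT.
rewrite /Iw /I/= ge0_integral_setU//; last 2 first.
  exact: (measurable_funTS mf).
  apply/disj_set2P/seteqP; split => // x [/= ra [ar _]].
  by move: ra; rewrite ltNge ar.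
rewrite /B EFinD leeD ?(ltW lt)//.
apply: (@le_trans _ _ (\int[mu]_(x in [set x | (r x < a)%R])
    ((expR (h * w a))%:E * (m e x)%:E))%E).
  apply: ge0_le_integral => //.
  - exact: (measurable_funTS mf).
  - apply: measurable_funTS; apply: measurable_funeM; apply/measurable_EFinP;
      exact: mm.
  - move=> x /= ra; rewrite -EFinM lee_fin mulrC ler_wpM2r// ler_expR
      ler_wpM2l//.
    by case: ww => -[_ nd _ _] _; apply: nd => //; exact: ltW.
have mme : measurable_fun setT (fun x => (m e x)%:E).
  by apply/measurable_EFinP; exact: mm.
have m0e x : (0 <= (m e x)%:E)%E by rewrite lee_fin.
rewrite (ge0_integralZl mu (mball a) (measurable_funTS mme)
  (fun x _ => m0e x)); last first.
  by rewrite lee_fin expR_ge0.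
rewrite [C0 * _]mulrC EFinM; apply: lee_wpmul2l;
  first by rewrite lee_fin expR_ge0.
by apply: le_trans hC; exact: ge0_subset_integral.
Qed.

(** A gliding hump. If no [h] works, choose parameters [e] tending to 0 and
    consecutive annuli such that the mass of [m e] on the annulus of index [n],
    for the weight [w / (n + 1)], is at least [n]. The function [F] equal to
    [w / (n + 1)] on that annulus is [o(w)], so [weight_minorant] puts it below
    some [w2 << w], and the bound for [w2] fails along the chosen parameters. *)
Lemma uniform_weight :
  (forall w2, weight w2 -> weight_ll w2 w -> exists C,
    \forall e \near 0^'+, (I w2 e setT <= C%:E)%E) ->
  exists2 h, 0 < h & exists C, \forall e \near 0^'+, (Iw h e setT <= C%:E)%E.
Proof.
move=> bdd; apply: contrapT => nobd.
(* Any weight below [w] bounds the unweighted mass, as [expR] is at least 1. *)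
have [v0 [wv0 v0w _]] : exists v0, [/\ weight v0, weight_ll v0 w &
    forall M, \forall t \near +oo, 0 + M <= v0 t].
  apply: (@weight_minorant _ _ (fun=> 0)) => // k k0.
  near=> t; apply: mulr_ge0; first exact: ltW.
  by apply: weight_ge0 => //; near: t; exact: nbhs_pinfty_ge.
have [C0 /near0P[d0 d00 hC0]] := bdd _ wv0 v0w.
have mass e : 0 < e -> e < 1 -> e < d0 -> (\int[mu]_x (m e x)%:E <= C0%:E)%E.
  move=> e0 e1 ed; apply: le_trans (hC0 _ e0 ed); apply: ge0_le_integral => //.
  - by move=> x _; rewrite lee_fin.
  - by apply/measurable_EFinP; exact: mm.
  - apply: measurable_integrand => //; exact: measurable_weight_comp.
  - move=> x _; rewrite lee_fin ler_peMr// -expR0 ler_expR.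
    exact: weight_ge0.
have step (p : nat * R) : exists q : R * R, 0 <= p.2 ->
    [/\ 0 < q.1, q.1 < 1, q.1 < p.1.+1%:R^-1, p.2 + 1 <= q.2 &
     (p.1%:R%:E <= Iw p.1.+1%:R^-1 q.1 (annulus p.2 q.2))%E].
  case: p => n a /=; set h := n.+1%:R^-1.
  have [a0|a0] := leP 0 a; last by exists (0, 0).
  have h0 : 0 < h by rewrite invr_gt0.
  pose B := C0 * expR (h * w a) + n%:R.
  have [e [e0 [e1 ed eh big]]] : exists e, 0 < e /\
      [/\ e < 1, e < d0, e < h & (B%:E < Iw h e setT)%E].
    apply: contrapT => none; apply: nobd; exists h => //; exists B.
    apply/near0P; exists (Num.min 1 (Num.min d0 h)).
      by rewrite !lt_min ltr01 d00 h0.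
    move=> e e0; rewrite !lt_min => /and3P[e1 ed eh].
    rewrite leNgt; apply/negP => big; apply: none.
    by exists e; split.
  have [b ab nb] :=
    escaping_mass e0 e1 (ltW h0) a0 (ler0n _ n) (mass e e0 e1 ed) big.
  by exists (e, b).
have [q hq] := choice step.
(* The radii: the outer one of an annulus is the inner one of the next. *)
pose fix Rs (n : nat) : R := if n is k.+1 then (q (k, Rs k)).2 else 0.
have Rs_ge n : n%:R <= Rs n.
  elim: n => [//|n IHn].
  have [_ _ _ + _] := hq (n, Rs n) (le_trans (ler0n _ _) IHn).
  by apply: le_trans; rewrite -natr1 lerD2r.
have Rs0 n : 0 <= Rs n by exact: le_trans (ler0n _ n) (Rs_ge n).
have Rs_nd : {homo Rs : i j / (i <= j)%N >-> i <= j}.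
  apply: homo_leq => [//|y x z|n]; first exact: le_trans.
  have [_ _ _ + _] := hq (n, Rs n) (Rs0 n).
  by apply: le_trans; rewrite lerDl.
have /choice[idx hidx] (t : R) : exists n : nat, 0 <= t -> Rs n <= t < Rs n.+1.
  have [t0|t0] := leP 0 t; last by exists 0%N; rewrite leNgt t0.
  have ex : exists n, t < Rs n.+1.
    exists (Num.truncn t); apply: lt_le_trans (Rs_ge _); exact: truncnS_gt.
  case: (ex_minnP ex) => n tn nmin; exists n => _; rewrite tn andbT.
  case: n tn nmin => [//|n] tn nmin; rewrite leNgt; apply/negP => /nmin.
  by rewrite ltnn.
(* [idx t] is the index of the annulus that contains the radius [t]. *)
pose F t := w t / (idx t).+1%:R.
have [|w2 [ww2 w2w Fw2]] := @weight_minorant _ w F ww.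
  move=> k k0; pose N := Num.truncn k^-1.
  near=> t.
  have t0 : 0 <= t by near: t; exact: nbhs_pinfty_ge.
  have NRt : Rs N <= t by near: t; apply: nbhs_pinfty_ge; exact: num_real.
  rewrite /F mulrC ler_wpM2r ?weight_ge0// invf_ple ?posrE//.
  have Nidx : (N <= idx t)%N.
    rewrite leqNgt; apply/negP => idxN.
    have /andP[_] := hidx t t0; rewrite ltNge => /negP; apply.
    exact: le_trans (Rs_nd _ _ idxN) NRt.
  by rewrite (le_trans (ltW (truncnS_gt _)))// ler_nat.
have [C /near0P[dl dl0 hC]] := bdd _ ww2 w2w.
have [M [_ hM]] := Fw2 0.
(* Large enough for the annulus to lie where [F <= w2], for its mass to exceed
   [C], and for its parameter to be in the range where the bound [C] holds. *)
pose n := (Num.truncn (`|M| + `|C| + dl^-1)).+1.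
have nbig : `|M| + `|C| + dl^-1 < n%:R by exact: truncnS_gt.
have dli : 0 < dl^-1 by rewrite invr_gt0.
have [e0 e1 eh _ nI] := hq (n, Rs n) (Rs0 n).
set e := (q (n, Rs n)).1 in e0 e1 eh nI.
have ed : e < dl.
  apply: (lt_trans eh); rewrite /= invf_plt ?posrE//.
  rewrite (@lt_trans _ _ n%:R) ?ltr_nat// (le_lt_trans _ nbig)//.
  by rewrite lerDr addr_ge0.
have : (Iw n.+1%:R^-1 e (annulus (Rs n) (Rs n.+1)) <= C%:E)%E.
  apply: le_trans (hC e e0 ed).
  apply: (@le_trans _ _ (I w2 e (annulus (Rs n) (Rs n.+1)))); last first.
    apply: ge0_subset_integral => //.
    by apply: measurable_integrand => //; exact: measurable_weight_comp.
  apply: ge0_le_integral => //.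
  - by move=> x _; exact: (integrand_ge0 (fun t => n.+1%:R^-1 * w t)).
  - apply: measurable_funTS; apply: (@measurable_integrand (fun t =>
      n.+1%:R^-1 * w t)) => //.
    by apply: measurable_funM => //; exact: measurable_weight_comp.
  - apply: measurable_funTS; apply: measurable_integrand => //;
      exact: measurable_weight_comp.
  - move=> x [Rx xR]; rewrite lee_fin ler_wpM2l// ler_expR.
    have rx0 := r0 x.
    have Mr : M < r x.
      rewrite (le_lt_trans (ler_norm _))//; apply: lt_le_trans Rx.
      apply: lt_le_trans (Rs_ge n); apply: le_lt_trans nbig.
      by rewrite -addrA lerDl addr_ge0// ltW.
    have := hM _ Mr; rewrite addr0; apply: le_trans; rewrite /F mulrC.
    rewrite ler_wpM2l ?weight_ge0// lef_pV2 ?posrE// ler_nat ltnS leqNgt.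
    apply/negP => nidx; have /andP[+ _] := hidx _ rx0.
    rewrite leNgt => /negP; apply; exact: lt_le_trans xR (Rs_nd _ _ nidx).
move=> /(le_trans nI); rewrite lee_fin leNgt => /negP; apply.
rewrite (le_lt_trans (ler_norm _))// (le_lt_trans _ nbig)//.
by rewrite addrAC lerDr addr_ge0// ltW.
Unshelve. all: by end_near. Qed.

End gliding_hump.

(** * The two notions of regularity *)
Section regularity.
Context {R : realType} {d : nat}.
Local Notation Rd := 'rV[R]_d.
Local Notation lam := (@lebesgue_rV R d).
Implicit Types (w : R -> R) (Omega K : set Rd) (f g chi psi : Rd -> R[i]).

Lemma wnorm_ge0 w l f : (0 <= wnorm w l f)%E.
Proof.
by apply: integral_ge0 => x _; rewrite lee_fin mulr_ge0 ?normc_ge0 ?expR_ge0.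
Qed.

Lemma wseminorm_ge0 w Omega K s l f : (0 <= wseminorm w Omega K s l f)%E.
Proof. by apply/ereal_infP => _ [psi _ <-]; exact: wnorm_ge0. Qed.

(** The constant does not depend on [f], which is what lets the inequality pass
    to the infimum over cutoffs and to nets. *)
Lemma wnorm_ll w w2 h : weight w -> weight w2 -> weight_ll w2 w -> 0 < h ->
  exists C, forall f, cmeasurable f ->
    (wnorm w2 1 f <= (expR C)%:E * wnorm w h f)%E.
Proof.
move=> ww ww2 w2w h0; have [C hC] := weight_ll_bound ww ww2 w2w h0.
exists C => f mf; have mI := measurable_wnorm_integrand h ww mf.
rewrite /wnorm -ge0_integralZl//; last first.
  by move=> x _; rewrite lee_fin mulr_ge0 ?normc_ge0 ?expR_ge0.
apply: ge0_le_integral => //.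
- by move=> x _; rewrite lee_fin mulr_ge0 ?normc_ge0 ?expR_ge0.
- exact: measurable_wnorm_integrand.
- exact: measurable_funeM mI.
- move=> x _; rewrite -EFinM lee_fin mulrCA ler_wpM2l ?normc_ge0// -expRD
    ler_expR.
  by rewrite mul1r addrC hC// enorm_ge0.
Qed.

Lemma wseminorm_ll w w2 h Omega K :
  weight w -> weight w2 -> weight_ll w2 w -> 0 < h ->
  exists C, forall f, local_functions w Omega f ->
    (wseminorm w Omega K w2 1 f <= (expR C)%:E * wseminorm w Omega K w h f)%E.
Proof.
move=> ww ww2 w2w h0; have [C hC] := wnorm_ll ww ww2 w2w h0.
exists C => f [_ _ lf]; rewrite -lee_pdivrMl ?expR_gt0//.
apply/ereal_infP => _ [psi [tpsi psi1] <-]; rewrite lee_pdivrMl ?expR_gt0//.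
have [cpf _ _ _] := lf _ tpsi.
apply: le_trans (hC _ (ccontinuous_measurable cpf)).
by apply: ereal_inf_lbound; exists psi.
Qed.

(** The logarithm of the net of seminorms is [o(w (1/e))]; [weight_minorant] turns
    it into a weight [w1], with room for the constant of [wseminorm_ll]. *)
Lemma regular_nets_sub w Omega : weight w ->
  regular_nets w Omega `<=` regular_nets_tilde w Omega.
Proof.
move=> ww g [mg rg]; split => // K cK KO; have [h h0 hk] := rg K cK KO.
pose a e := wseminorm w Omega K w h (g e).
(* The maximum keeps the logarithm meaningful where the seminorm vanishes. *)
pose F t := ln (Num.max 1 (fine (a t^-1))).
have [k k0|w1 [ww1 w1w Fw1]] := @weight_minorant _ w F ww.
  have /near0_invP near_a := hk k k0 1 ltr01.
  near=> t.
  have t0 : 0 <= t by near: t; exact: nbhs_pinfty_ge.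
  have at_le : (a (t^-1)%R <= (1 * expR (k * w t^-1^-1))%:E)%E.
    by near: t; exact: near_a.
  rewrite mul1r invrK in at_le.
  rewrite /F -[leRHS]expRK ler_ln ?posrE ?expR_gt0 ?lt_max ?ltr01//.
  rewrite ge_max -[X in X <= _]expR0 ler_expR mulr_ge0 ?(ltW k0) ?weight_ge0//=.
  rewrite -lee_fin fineK// ge0_fin_numE ?wseminorm_ge0//.
  by rewrite (le_lt_trans at_le)// ltry.
exists w1; split => // w2 ww2 w2w c c0.
have [C hC] := wseminorm_ll Omega K ww ww2 w2w h0.
have /near_pinfty_invP nF := Fw1 (C - ln c).
have na := hk 1 ltr01 1 ltr01.
near=> e.
have e0 : 0 < e by near: e; exact: nbhs_right_gt.
have e1 : e < 1 by near: e; exact: nbhs_right_lt.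
apply: le_trans (hC _ (mg.1 e e0 e1)) _.
have afin : a e \is a fin_num.
  rewrite ge0_fin_numE ?wseminorm_ge0//.
  have : (a e <= (1 * expR (1 * w e^-1))%:E)%E by near: e.
  by move=> /le_lt_trans; apply; rewrite ltry.
have nFe : F e^-1 + (C - ln c) <= w1 e^-1 by near: e.
rewrite -/(a e) -(fineK afin) -EFinM lee_fin.
apply: (@le_trans _ _ (expR C * expR (F e^-1))).
  rewrite ler_wpM2l ?expR_ge0// /F invrK lnK ?posrE ?lt_max ?ltr01//.
  by rewrite le_max lexx orbT.
rewrite -[c in leRHS]lnK ?posrE// -!expRD ler_expR.
by rewrite -lerBlDl addrAC addrC.
Unshelve. all: by end_near. Qed.

(** A seminorm is an infimum over cutoffs that may change with the weight and with
    the net index. Every cutoff [psi] equal to 1 on the support of [chi] satisfies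
    [chi * g = chi * (psi * g)], so submultiplicativity bounds the norm of
    [chi * g], for the fixed cutoff [chi], by each of the competing norms. *)
Lemma cutoff_bound w w2 Omega chi :
  weight w -> weight w2 -> weight_ll w2 w -> test_functions w Omega chi ->
  exists2 C, 0 < C & forall g, local_functions w Omega g ->
    (wnorm w2 1 (fun x => (chi x * g x)%R) <=
     C%:E * wseminorm w Omega (csupport chi) w2 1 g)%E.
Proof.
move=> ww ww2 w2w tchi; case: (tchi) => cchi Kchi chiO [l l0 chil].
have [C1 hC1] := wnorm_ll ww ww2 w2w l0.
have chi2 : (wnorm w2 1 chi < +oo)%E.
  apply: le_lt_trans (hC1 _ (ccontinuous_measurable cchi)) _.
  by rewrite lte_mul_pinfty// lee_fin expR_ge0.
have [_ [c c0 cE]] := @cintegrable_poisson R d.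
pose A := fine (wnorm w2 1 chi).
have AE : wnorm w2 1 chi = A%:E by rewrite fineK// ge0_fin_numE ?wnorm_ge0.
have A0 : 0 <= A by rewrite fine_ge0// wnorm_ge0.
have C0 : 0 < c^-1 * (A + 1) by rewrite mulr_gt0 ?invr_gt0// ltr_wpDl.
exists (c^-1 * (A + 1)) => // g [_ _ lg].
rewrite -lee_pdivrMl//; apply/ereal_infP => _ [psi [tpsi psi1] <-].
rewrite lee_pdivrMl//.
have E : (fun x => chi x * g x) = (fun x => chi x * (psi x * g x)).
  apply/funext => x; have [sx|/csupport_eq0 ->] := pselect (csupport chi x).
    by rewrite psi1// mul1r.
  by rewrite !mul0r.
have [cpg Kpg _ _] := lg _ tpsi.
have alg (X Y : \bar R) : (0 <= Y)%E -> (c%:E * X <= A%:E * Y)%E ->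
    (X <= (c^-1 * (A + 1))%:E * Y)%E.
  move=> Y0 XY; rewrite EFinM -muleA lee_pdivlMl// (le_trans XY)//.
  by apply: lee_wpmul2r => //; rewrite lee_fin lerDl.
apply: alg; first exact: wnorm_ge0.
rewrite E -AE.
have le := wnormM ww2 ler01 c0 cE cchi Kchi chi2 cpg Kpg.
exact: le.
Qed.

(** Without a cutoff equal to 1 on [K] the seminorms over [K] would be infima of
    the empty set, hence infinite; so moderateness itself provides one. *)
Lemma moderate_cutoff w Omega K (g : R -> Rd -> R[i]) :
  moderate_nets w Omega g -> compact K -> K `<=` Omega ->
  exists2 chi, test_functions w Omega chi & forall x, K x -> chi x = 1.
Proof.
move=> [_ mg] cK KO; have [h h0 hg] := mg K cK KO 1 ltr01.
have /near0P[dl dl0 hdl] := hg 1 ltr01.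
have := hdl (dl / 2) (divr_gt0 dl0 (ltr0n _ 2)) _.
rewrite ltr_pdivrMr// ltr_pMr// ltr1n => /(_ isT) he.
apply: contrapT => nochi; move: he; rewrite /wseminorm.
have -> : [set psi | test_functions w Omega psi /\
    forall x, K x -> psi x = 1] = set0.
  by apply/seteqP; split => // psi [tpsi psi1]; apply: nochi; exists psi.
by rewrite image_set0 ereal_inf0.
Qed.

(** Fix a cutoff [chi] equal to 1 on [K] and apply the hypothesis on its support.
    By [cutoff_bound] the functions [chi * g e], normalized by
    [expR (- w1 (1/e))], are bounded for every weight [w2 << w], hence by
    [uniform_weight] for one multiple of [w]; and [w1 << w] makes the
    normalization negligible. *)
Lemma regular_nets_tilde_sub w Omega : weight w ->
  regular_nets_tilde w Omega `<=` regular_nets w Omega.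
Proof.
move=> ww g [mg tg]; split => // K cK KO.
have [chi tchi chi1] := moderate_cutoff mg cK KO.
have [cchi Kchi chiO _] := tchi.
have [w1 [ww1 w1w hw1]] := tg _ Kchi chiO.
pose f e x := chi x * g e x.
have mf e : 0 < e -> e < 1 -> cmeasurable (f e).
  move=> e0 e1; have [_ _ lg] := mg.1 e e0 e1.
  by have [cf _ _ _] := lg _ tchi; exact: ccontinuous_measurable.
pose m e xi := expR (- w1 e^-1) * normc (fourier (f e) xi).
have m0 e xi : 0 <= m e xi by rewrite mulr_ge0 ?expR_ge0 ?normc_ge0.
have mm e : 0 < e -> e < 1 -> measurable_fun setT (m e).
  move=> e0 e1; apply: measurable_funM => //.
  exact: measurable_normc (cmeasurable_fourier (mf e e0 e1)).
have mE (v : R -> R) l e : weight v -> 0 < e -> e < 1 ->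
    (\int[lam]_xi (m e xi * expR (l * v (enorm xi)))%:E =
     (expR (- w1 e^-1))%:E * wnorm v l (f e))%E.
  move=> wv e0 e1; rewrite /wnorm -ge0_integralZl//.
  - by apply: eq_integral => xi _; rewrite -EFinM /m mulrA.
  - exact: (measurable_wnorm_integrand l wv (mf e e0 e1)).
  - by move=> x _; rewrite lee_fin mulr_ge0 ?normc_ge0 ?expR_ge0.
have [|h h0 [C hC]] :=
  @uniform_weight _ _ R lam (@enorm R d) m w ww (@enorm_ge0 R d)
    (@measurable_enorm R d) m0 mm.
  move=> w2 ww2 w2w; have [C C0 hC] := cutoff_bound ww ww2 w2w tchi.
  have nw := hw1 w2 ww2 w2w 1 ltr01.
  exists C; near=> e.
  have e0 : 0 < e by near: e; exact: nbhs_right_gt.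
  have e1 : e < 1 by near: e; exact: nbhs_right_lt.
  under eq_integral => xi _ do rewrite -[w2 _]mul1r.
  rewrite mE// expRN lee_pdivrMl ?expR_gt0//.
  apply: le_trans (hC _ (mg.1 e e0 e1)) _.
  rewrite muleC; apply: lee_wpmul2r; first by rewrite lee_fin ltW.
  have : (wseminorm w Omega (csupport chi) w2 1 (g e) <=
      (1 * expR (w1 e^-1))%:E)%E by near: e.
  by rewrite mul1r.
exists h => // k k0 c c0.
have k20 : 0 < k / 2 by rewrite divr_gt0.
have /near_pinfty_invP nw1 := w1w _ k20.
have /near_pinfty_invP nwC : \forall t \near +oo, (`|C| / c) / (k / 2) <= w t.
  exact: weight_cvgy.
near=> e.
have e0 : 0 < e by near: e; exact: nbhs_right_gt.
have e1 : e < 1 by near: e; exact: nbhs_right_lt.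
have ei0 : 0 <= e^-1 by rewrite invr_ge0 ltW.
have le1 : w1 e^-1 <= k / 2 * w e^-1.
  have : `|w1 e^-1| <= k / 2 * `|w e^-1| by near: e.
  by rewrite (ger0_norm (weight_ge0 ww1 ei0)) (ger0_norm (weight_ge0 ww ei0)).
have leC : (`|C| / c) / (k / 2) <= w e^-1 by near: e.
have hCe : (\int[lam]_xi (m e xi * expR (h * w (enorm xi)))%:E <= C%:E)%E.
  by near: e.
rewrite mE// expRN lee_pdivrMl ?expR_gt0// in hCe.
apply: (@le_trans _ _ (wnorm w h (f e))).
  by apply: ereal_inf_lbound; exists chi.
apply: (le_trans hCe); rewrite -EFinM lee_fin [k]splitr mulrDl expRD.
apply: (@le_trans _ _ (expR (w1 e^-1) * `|C|)).
  by rewrite ler_wpM2l ?expR_ge0// ler_norm.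
rewrite mulrA [leRHS]mulrC ler_pM ?expR_ge0// ?ler_expR//.
rewrite -ler_pdivrMl// mulrC (@le_trans _ _ (k / 2 * w e^-1))//.
  by rewrite -ler_pdivrMl// [leLHS]mulrC.
by apply: le_trans (expR_ge1Dx _); rewrite lerDr.
Unshelve. all: by end_near. Qed.

End regularity.

Theorem proposition6p7 (R : realType) (d : nat) (Omega : set 'rV[R]_d)
    (w : R -> R) :
  open Omega -> weight w ->
  regular_nets w Omega = regular_nets_tilde w Omega.
Proof.
move=> _ ww; apply/seteqP; split.
- exact: regular_nets_sub.
- exact: regular_nets_tilde_sub.
Qed.
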